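(* Let $m\ge1$. The free $\mathrm{Dyck}^m$ algebra on one generator is isomorphic, as a $\mathrm{Dyck}^m$ algebra, to $(\mathbb K[\mathrm{Dy}^m],*_0,\dots,*_m)$.
   Context: $\mathbb K$ is a field. A $\mathrm{Dyck}^m$ algebra is a $\mathbb K$-vector space $D$ with bilinear operations $*_0,\dots,*_m$ such that for all $x,y,z\in D$: (1) $x*_i(y*_jz)=(x*_iy)*_jz$ for $0\le i<j\le m$; (2) $\sum_{j=0}^i x*_i(y*_jz)=\sum_{k=i}^m (x*_ky)*_iz$ for $0\le i\le m$. Fix $m\ge1$. An $m$-Dyck path of size $n$ is a path in $\mathbb R^2$ from $(0,0)$ to $(2nm,0)$ made of up steps $(m,m)$ and down steps $(1,-1)$, never going below the $x$-axis (so it has $n$ up steps). $\mathrm{Dy}_n^m$ is the set of those of size $n$, and $\mathbb K[\mathrm{Dy}^m]$ is the vector space with basis $\bigcup_{n\ge1}\mathrm{Dy}_n^m$. A down step has level $k$ if the last up step before it is the $k$-th up step from the left; $L_k(P)$ is the number of down steps of level $k$, and $L(P):=L_n(P)$ for $P$ of size $n$. A path is determined by, and written as, $((L_1(P),\dots,L_{n-1}(P),L(P)))$. Concatenations: for $P$ of size $n$, $Q$ of size $r$, $0\le i\le L(P)$, $P\times_iQ:=((L_1(P),\dots,L_{n-1}(P),L(P)-i,L_1(Q),\dots,L_{r-1}(Q),L(Q)+i))$. A path is prime if it is not of the form $Q\times_0R$ with $Q,R$ of size $\ge1$. Every path of size $\ge 1$ is uniquely $Q_1\times_0\dots\times_0Q_r$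 with all $Q_j$ prime of size $\geq 1$. Standard coloring $\alpha_P$ from the down steps of $P$ to $\{1,\dots,n\}$: write uniquely $P=u\,P_0\,d\,P_1\,d\cdots d\,P_m$, where $u$ is the first up step, the $m$ displayed $d$ are down steps, and $P_j$ is a (possibly empty, translated) $m$-Dyck path of size $n_j$; then $\alpha_P=1$ on the displayed down steps and $\alpha_P(d)=\alpha_{P_j}(d)+n_0+\dots+n_{j-1}+1$ for $d$ in $P_j$. For $P$ of size $n$, $\omega_n^P$ is the word of colors of the down steps of level $n$, read left to right (length $L(P)$). Let $\Lambda_r(P)$ be the set of $\lambda=(\lambda_0,\dots,\lambda_r)$ of non-negative integers with sum $L(P)$, and $\Lambda_r^i(P)$ ($0\le i\le m$) the subset of those $\lambda$ such that in the word formed by the last $\lambda_r$ letters of $\omega_n^P$ every color appears at most $i$ times and some integer of $\{1,\dots,n\}$ appears exactly $i$ times (so $\lambda\in\Lambda_r^0(P)$ iff $\lambda_r=0$). For $Q=Q_1\times_0\dots\times_0Q_r$ with $Q_j$ prime and $\lambda\in\Lambda_r(P)$, $$P*_\lambda Q:=(\cdots((P\times_{\lambda_1+\dots+\lambda_r}Q_1)\times_{\lambda_2+\dots+\lambda_r}Q_2)\cdots)\times_{\lambda_r}Q_r .$$ Finally $P*_jQ:=\sum_{\lambda\in\Lambda_r^j(P)}P*_\lambda Q$ for $0\le j\le m$, extended bilinearly to $\mathbb K[\mathrm{Dy}^m]$. *)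

(* Defs.v *)
From HB Require Import structures.
From mathcomp Require Import all_boot all_order all_algebra finmap.
From mathcomp Require Import generic_quotient boolp.
From mathcomp Require Import monalg.
From mathcomp Require Import zify.

Set Implicit Arguments.
Unset Strict Implicit.
Unset Printing Implicit Defensive.

Import Order.TTheory GRing.Theory Num.Theory.
Local Open Scope ring_scope.
Local Open Scope quotient_scope.

Definition dyck_algebra (m : nat) (K : fieldType) (D : lmodType K)
    (op : 'I_m.+1 -> D -> D -> D) : Prop :=
  [/\ forall i x, linear (op i x),
      forall i y, linear (fun x => op i x y),
      forall (i j : 'I_m.+1) x y z, (i < j)%N ->
        op i x (op j y z) = op j (op i x y) z
    & forall (i : 'I_m.+1) x y z,
        \sum_(j < m.+1 | (j <= i)%N) op i x (op j y z) =
        \sum_(k < m.+1 | (i <= k)%N) op i (op k x y) z].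

Definition op_morphism (m : nat) (D E : Type)
    (opD : 'I_m.+1 -> D -> D -> D) (opE : 'I_m.+1 -> E -> E -> E)
    (f : D -> E) : Prop :=
  forall i x y, f (opD i x y) = opE i (f x) (f y).

Definition dyck_isomorphic (m : nat) (K : fieldType) (D E : lmodType K)
    (opD : 'I_m.+1 -> D -> D -> D) (opE : 'I_m.+1 -> E -> E -> E) : Prop :=
  exists f : {linear D -> E}, bijective f /\ op_morphism opD opE f.

(* (F, op) is a Dyck^m algebra, free on the single generator x. *)
Definition free_dyck_on_one (m : nat) (K : fieldType) (F : lmodType K)
    (op : 'I_m.+1 -> F -> F -> F) (x : F) : Prop :=
  dyck_algebra op /\
  forall (A : lmodType K) (opA : 'I_m.+1 -> A -> A -> A) (a : A),
    dyck_algebra opA ->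
    (exists f : {linear F -> A}, op_morphism op opA f /\ f x = a) /\
    (forall f g : {linear F -> A}, op_morphism op opA f -> f x = a ->
       op_morphism op opA g -> g x = a -> f =1 g).

(* Existence of the free algebra: terms modulo the congruence generated by the
   axioms. *)
Module FreeDyck.
Section FreeDyck.
Variables (m : nat) (K : fieldType).

Inductive term :=
  | Gen | Zero | Add of term & term | Scale of K & term
  | Op of 'I_m.+1 & term & term.

HB.instance Definition _ := gen_eqMixin term.
HB.instance Definition _ := gen_choiceMixin term.

Definition sumt (P : pred 'I_m.+1) (f : 'I_m.+1 -> term) : term :=
  foldr (fun j t => if P j then Add (f j) t else t) Zero
        (index_enum 'I_m.+1).

Inductive eqv : term -> term -> Prop :=
  | eqv_refl t : eqv t t
  | eqv_sym s t : eqv s t -> eqv t s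
  | eqv_trans s t u : eqv s t -> eqv t u -> eqv s u
  | eqv_add s s' t t' : eqv s s' -> eqv t t' -> eqv (Add s t) (Add s' t')
  | eqv_scale c t t' : eqv t t' -> eqv (Scale c t) (Scale c t')
  | eqv_op i s s' t t' : eqv s s' -> eqv t t' -> eqv (Op i s t) (Op i s' t')
  | eqv_addA s t u : eqv (Add s (Add t u)) (Add (Add s t) u)
  | eqv_addC s t : eqv (Add s t) (Add t s)
  | eqv_add0 t : eqv (Add Zero t) t
  | eqv_addN t : eqv (Add (Scale (-1) t) t) Zero
  | eqv_scaleA a b t : eqv (Scale a (Scale b t)) (Scale (a * b) t)
  | eqv_scale1 t : eqv (Scale 1 t) t
  | eqv_scaleDr c s t : eqv (Scale c (Add s t)) (Add (Scale c s) (Scale c t))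
  | eqv_scaleDl a b t : eqv (Scale (a + b) t) (Add (Scale a t) (Scale b t))
  | eqv_opl i c s t u :
      eqv (Op i (Add (Scale c s) t) u) (Add (Scale c (Op i s u)) (Op i t u))
  | eqv_opr i c s t u :
      eqv (Op i u (Add (Scale c s) t)) (Add (Scale c (Op i u s)) (Op i u t))
  | eqv_dyck1 (i j : 'I_m.+1) s t u : (i < j)%N ->
      eqv (Op i s (Op j t u)) (Op j (Op i s t) u)
  | eqv_dyck2 (i : 'I_m.+1) s t u :
      eqv (sumt (fun j : 'I_m.+1 => j <= i)%N (fun j => Op i s (Op j t u)))
          (sumt (fun k : 'I_m.+1 => i <= k)%N (fun k => Op i (Op k s t) u)).

Definition eqvb (s t : term) : bool := `[< eqv s t >].

Lemma eqvb_equiv : equiv_class_of eqvb.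
Proof.
split=> [t|s t|t s u].
- by apply/asboolP; apply: eqv_refl.
- by apply/asboolP/asboolP; apply: eqv_sym.
- by move=> /asboolP h1 /asboolP h2; apply/asboolP; apply: eqv_trans h1 h2.
Qed.

Canonical eqvb_rel := EquivRelPack eqvb_equiv.

Definition carrier := {eq_quot eqvb_rel}.
HB.instance Definition _ := Choice.on carrier.

Definition cls (t : term) : carrier := \pi_carrier t.

Lemma clsP s t : eqv s t <-> cls s = cls t.
Proof.
split=> [h|/eqquotP/asboolP//].
by apply/eqquotP/asboolP.
Qed.

Lemma eqv_repr t : eqv (repr (cls t)) t.
Proof. by apply/clsP; rewrite /cls reprK. Qed.

Lemma clsW (P : carrier -> Prop) : (forall t, P (cls t)) -> forall x, P x.
Proof. by move=> h x; rewrite -[x]reprK; apply: h. Qed.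

Definition qadd (x y : carrier) := cls (Add (repr x) (repr y)).
Definition qscale c (x : carrier) := cls (Scale c (repr x)).
Definition qop i (x y : carrier) := cls (Op i (repr x) (repr y)).

Lemma qaddE s t : qadd (cls s) (cls t) = cls (Add s t).
Proof. by apply/clsP; apply: eqv_add; apply: eqv_repr. Qed.
Lemma qscaleE c t : qscale c (cls t) = cls (Scale c t).
Proof. by apply/clsP; apply: eqv_scale; apply: eqv_repr. Qed.
Lemma qopE i s t : qop i (cls s) (cls t) = cls (Op i s t).
Proof. by apply/clsP; apply: eqv_op; apply: eqv_repr. Qed.

Fact qaddA : associative qadd.
Proof.
elim/clsW=> s; elim/clsW=> t; elim/clsW=> u; rewrite !qaddE.
by apply/clsP; apply: eqv_addA.
Qed.
Fact qaddC : commutative qadd.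
Proof.
by elim/clsW=> s; elim/clsW=> t; rewrite !qaddE; apply/clsP; apply: eqv_addC.
Qed.
Fact qadd0 : left_id (cls Zero) qadd.
Proof. by elim/clsW=> s; rewrite !qaddE; apply/clsP; apply: eqv_add0. Qed.
Fact qaddN : left_inverse (cls Zero) (qscale (-1)) qadd.
Proof.
by elim/clsW=> s; rewrite qscaleE qaddE; apply/clsP; apply: eqv_addN.
Qed.

HB.instance Definition _ :=
  GRing.isZmodule.Build carrier qaddA qaddC qadd0 qaddN.

Lemma clsD s t : cls s + cls t = cls (Add s t).
Proof. exact: qaddE. Qed.

Fact qscaleA a b (x : carrier) : qscale a (qscale b x) = qscale (a * b) x.
Proof.
by elim/clsW: x => s; rewrite !qscaleE; apply/clsP; apply: eqv_scaleA.
Qed.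
Fact qscale1 : left_id 1 qscale.
Proof. by elim/clsW=> s; rewrite !qscaleE; apply/clsP; apply: eqv_scale1. Qed.
Fact qscaleDr : right_distributive qscale +%R.
Proof.
move=> c; elim/clsW=> s; elim/clsW=> t; rewrite clsD !qscaleE clsD.
by apply/clsP; apply: eqv_scaleDr.
Qed.
Fact qscaleDl (x : carrier) : {morph qscale^~ x : a b / a + b}.
Proof.
elim/clsW: x => s a b; rewrite !qscaleE clsD.
by apply/clsP; apply: eqv_scaleDl.
Qed.

HB.instance Definition _ := GRing.Zmodule_isLmodule.Build K carrier
  qscaleA qscale1 qscaleDr qscaleDl.

Lemma clsZ c t : c *: cls t = cls (Scale c t).
Proof. exact: qscaleE. Qed.

Lemma cls_sumt P f : cls (sumt P f) = \sum_(j | P j) cls (f j).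
Proof.
rewrite /sumt unlock /=; elim: (index_enum _) => //= j s ih.
by case: (P j) => //; rewrite -ih clsD.
Qed.

Lemma qop_dyck : dyck_algebra qop.
Proof.
split.
- move=> i; elim/clsW=> u c; elim/clsW=> s; elim/clsW=> t.
  rewrite clsZ clsD !qopE clsZ clsD.
  by apply/clsP; apply: eqv_opr.
- move=> i; elim/clsW=> u c; elim/clsW=> s; elim/clsW=> t.
  rewrite clsZ clsD !qopE clsZ clsD.
  by apply/clsP; apply: eqv_opl.
- move=> i j; elim/clsW=> s; elim/clsW=> t; elim/clsW=> u ij.
  by rewrite !qopE; apply/clsP; apply: eqv_dyck1.
- move=> i; elim/clsW=> s; elim/clsW=> t; elim/clsW=> u.
  under eq_bigr do rewrite !qopE; under [RHS]eq_bigr do rewrite !qopE.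
  by rewrite -!cls_sumt; apply/clsP; apply: eqv_dyck2.
Qed.

Section Eval.
Variables (A : lmodType K) (opA : 'I_m.+1 -> A -> A -> A) (a : A).
Hypothesis dA : dyck_algebra opA.

Fixpoint eval (t : term) : A :=
  match t with
  | Gen => a | Zero => 0 | Add s t => eval s + eval t
  | Scale c t => c *: eval t | Op i s t => opA i (eval s) (eval t)
  end.

Lemma eval_sumt P f : eval (sumt P f) = \sum_(j | P j) eval (f j).
Proof.
rewrite /sumt unlock /=; elim: (index_enum _) => //= j s <-.
by case: (P j).
Qed.

Lemma eval_eqv s t : eqv s t -> eval s = eval t.
Proof.
case: dA => lr ll d1 d2.
elim=> //= {s t}.
- by move=> s t u _ -> _ ->.
- by move=> s s' t t' _ -> _ ->.
- by move=> c t t' _ ->.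
- by move=> i s s' t t' _ -> _ ->.
- by move=> s t u; rewrite addrA.
- by move=> s t; rewrite addrC.
- by move=> t; rewrite add0r.
- by move=> t; rewrite scaleN1r addNr.
- by move=> c d t; rewrite scalerA.
- by move=> t; rewrite scale1r.
- by move=> c s t; rewrite scalerDr.
- by move=> c d t; rewrite scalerDl.
- by move=> i c s t u; apply: ll.
- by move=> i c s t u; apply: lr.
- by move=> i j s t u ij; apply: d1.
- by move=> i s t u; rewrite !eval_sumt; apply: d2.
Qed.

Definition qeval (x : carrier) := eval (repr x).
Lemma qevalE t : qeval (cls t) = eval t.
Proof. exact/eval_eqv/eqv_repr. Qed.

Fact qeval_linear : linear qeval.
Proof.
move=> c; elim/clsW=> s; elim/clsW=> t.
by rewrite clsZ clsD !qevalE.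
Qed.
HB.instance Definition _ := GRing.isLinear.Build K carrier A _ qeval
  qeval_linear.

Lemma free_ex :
  exists f : {linear carrier -> A}, op_morphism qop opA f /\ f (cls Gen) = a.
Proof.
exists qeval; split; last by rewrite /= qevalE.
by move=> i; elim/clsW=> s; elim/clsW=> t; rewrite qopE /= !qevalE.
Qed.

Lemma free_uniq (f g : {linear carrier -> A}) :
  op_morphism qop opA f -> f (cls Gen) = a ->
  op_morphism qop opA g -> g (cls Gen) = a -> f =1 g.
Proof.
move=> fM fa gM ga; elim/clsW; elim=> [||s hs t ht|c t ht|i s hs t ht].
- by rewrite fa.
- by rewrite (_ : cls Zero = 0) // !linear0.
- by rewrite -clsD !linearD hs ht.
- by rewrite -clsZ !linearZ /= ht.
- by rewrite -qopE fM gM hs ht.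
Qed.
End Eval.

Lemma free : free_dyck_on_one qop (cls Gen).
Proof.
split=> [|A opA a dA]; first exact: qop_dyck.
by split; [apply: free_ex | move=> f g; apply: free_uniq].
Qed.
End FreeDyck.
End FreeDyck.

Theorem free_dyck_exists (m : nat) (K : fieldType) :
  exists (F : lmodType K) (op : 'I_m.+1 -> F -> F -> F) (x : F),
    free_dyck_on_one op x.
Proof. by eexists; eexists; eexists; apply: FreeDyck.free. Qed.

(* A path is its word of steps: [true] is the up step (m, m) and [false] the
   down step (1, -1).  Between lattice points the path is monotone, so it stays
   above the axis as soon as every prefix has nonnegative height. *)
Definition abscissa (m : nat) (w : seq bool) : nat :=
  (\sum_(s <- w) if s then m else 1)%N.

Definition height (m : nat) (w : seq bool) : int :=
  \sum_(s <- w) if s then m%:Z else -1.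

Definition mdyck (m n : nat) (w : seq bool) : bool :=
  [&& abscissa m w == (2 * n * m)%N, height m w == 0
    & all (fun k => 0 <= height m (take k w)) (iota 0 (size w).+1)].

Definition nups (w : seq bool) : nat := count_mem true w.

(* The levels of the down steps, from left to right, when k up steps have
   already been read. *)
Fixpoint down_levels_from (k : nat) (w : seq bool) : seq nat :=
  match w with
  | [::] => [::]
  | true :: w' => down_levels_from k.+1 w'
  | false :: w' => k :: down_levels_from k w'
  end.
Definition down_levels := down_levels_from 0.

Definition level (k : nat) (w : seq bool) : nat := count_mem k (down_levels w).

(* (L_1, ..., L_n) *)
Definition levels (w : seq bool) : seq nat :=
  [seq level k w | k <- iota 1 (nups w)].

Definition of_levels (s : seq nat) : seq bool :=
  flatten [seq true :: nseq k false | k <- s].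

(* Dy m is the union of the sets Dy_n^m, n >= 1: the size of a path is its
   number of up steps. *)
Record Dy (m : nat) := DyPath {
  steps :> seq bool;
  stepsP : (0 < nups steps)%N && mdyck m (nups steps) steps }.

HB.instance Definition _ m := [isSub for @steps m].
HB.instance Definition _ m := [Countable of Dy m by <:].

Definition dsize (m : nat) (P : Dy m) : nat := nups P.

Definition last_level (m : nat) (P : Dy m) : nat := level (dsize P) P.

Definition cat_levels (s : seq nat) (i : nat) (t : seq nat) : seq nat :=
  rcons (take (size s).-1 s) (last 0%N s - i)%N ++
  rcons (take (size t).-1 t) (last 0%N t + i)%N.

(* P \times_i Q; the default value of insubd is only used when
   i > last_level P, see levels_pcat below; by last_level_pcat this does not
   happen in the iterated products of lambda_mul. *)
Definition pcat (m : nat) (P : Dy m) (i : nat) (Q : Dy m) : Dy m :=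
  insubd P (of_levels (cat_levels (levels P) i (levels Q))).

Definition prime_path (m : nat) (P : Dy m) : Prop :=
  forall Q R : Dy m, P <> pcat Q 0 R.

(* Cuts w after each step ending on the axis; h is the current height and acc
   the current piece. *)
Fixpoint cut_returns (m h : nat) (acc w : seq bool) : seq (seq bool) :=
  match w with
  | [::] => [::]
  | s :: w' =>
      let h' := if s then (h + m)%N else h.-1 in
      if h' == 0%N then rcons acc s :: cut_returns m 0 [::] w'
      else cut_returns m h' (rcons acc s) w'
  end.

(* The sequence of the prime factors of P; see factorsP and factors_uniq
   below. *)
Definition factors (m : nat) (P : Dy m) : seq (Dy m) :=
  pmap insub (cut_returns m 0 [::] P).

(* If w = P_0 d w' with P_0 a possibly empty path and h = 0, the result is
   (P_0, w'). *)
Fixpoint cut_descent (m h : nat) (w : seq bool) : seq bool * seq bool :=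
  match w with
  | [::] => ([::], [::])
  | true :: w' => let: (p, q) := cut_descent m (h + m)%N w' in (true :: p, q)
  | false :: w' =>
      if h is h'.+1 then
        let: (p, q) := cut_descent m h' w' in (false :: p, q)
      else ([::], w')
  end.

(* [:: P_0; ...; P_k] for w = P_0 d P_1 d ... d P_k. *)
Fixpoint pieces (m k : nat) (w : seq bool) : seq (seq bool) :=
  if k is k'.+1 then
    let: (p, q) := cut_descent m 0 w in p :: pieces m k' q
  else [:: w].

(* The colors of P_0 d P_1 d ... d P_k, from the colorings cs of the
   ps = [:: P_0; ...; P_k]. *)
Definition glue_colors (ps : seq (seq bool)) (cs : seq (seq nat)) : seq nat :=
  flatten
    [seq (if j is 0%N then [::] else [:: 1%N]) ++
         [seq (c + sumn [seq nups p | p <- take j ps] + 1)%N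
         | c <- nth [::] cs j]
    | j <- iota 0 (size ps)].

Fixpoint coloring_rec (m fuel : nat) (w : seq bool) : seq nat :=
  match fuel, w with
  | fuel'.+1, _ :: w' =>
      let ps := pieces m m w' in
      glue_colors ps [seq coloring_rec m fuel' p | p <- ps]
  | _, _ => [::]
  end.

(* The colors of the down steps of w, from left to right; see coloring_eq
   and join_down_Dy below for the recursive equation. *)
Definition coloring (m : nat) (w : seq bool) : seq nat :=
  coloring_rec m (size w) w.

Definition last_colors (m : nat) (P : Dy m) : seq nat :=
  mask [seq k == dsize P | k <- down_levels P] (coloring m P).

Definition Lambda (m : nat) (P : Dy m) (r : nat) :
    {set {ffun 'I_r.+1 -> 'I_(last_level P).+1}} :=
  [set l : {ffun 'I_r.+1 -> 'I_(last_level P).+1} |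
     (\sum_j l j)%N == last_level P].

Definition bounded_by (n i : nat) (w : seq nat) : bool :=
  all (fun c => count_mem c w <= i)%N (iota 1 n) &&
  has (fun c => count_mem c w == i) (iota 1 n).

(* By size_last_colors below, the word tested here consists of the last l_r
   letters of last_colors P. *)
Definition LambdaI (m : nat) (i : nat) (P : Dy m) (r : nat) :
    {set {ffun 'I_r.+1 -> 'I_(last_level P).+1}} :=
  [set l in Lambda P r |
     bounded_by (dsize P) i
       (drop (size (last_colors P) - l ord_max) (last_colors P))].

(* star P [:: Q_1; ...; Q_r] [:: l_1; ...; l_r] is
   (...(P \times_{l_1+...+l_r} Q_1)...) \times_{l_r} Q_r. *)
Fixpoint star (m : nat) (P : Dy m) (Qs : seq (Dy m)) (ls : seq nat) : Dy m :=
  match Qs, ls with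
  | Q :: Qs', l :: ls' => star (pcat P (sumn (l :: ls')) Q) Qs' ls'
  | _, _ => P
  end.

Definition lambda_mul (m : nat) (P Q : Dy m)
    (l : {ffun 'I_(size (factors Q)).+1 -> 'I_(last_level P).+1}) : Dy m :=
  star P (factors Q) (behead [seq val (l j) | j <- enum 'I_(size (factors Q)).+1]).

Definition basis_mul (K : fieldType) (m : nat) (i : nat) (P Q : Dy m) :
    {malg K[Dy m]} :=
  \sum_(l in LambdaI i P (size (factors Q))) << lambda_mul l >>.

Definition dy_mul (K : fieldType) (m : nat) (i : 'I_m.+1)
    (x y : {malg K[Dy m]}) : {malg K[Dy m]} :=
  \sum_(P <- msupp x) \sum_(Q <- msupp y) (x@_P * y@_Q) *: basis_mul K i P Q.

Section Words.
Variable m : nat.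
Implicit Types (w p q u v : seq bool) (s t : seq nat).

Definition nonneg_from (h : int) w :=
  forall k, 0 <= h + height m (take k w).

Lemma height_cat u v : height m (u ++ v) = height m u + height m v.
Proof. by rewrite /height big_cat. Qed.

Lemma height_cons b w :
  height m (b :: w) = (if b then m%:Z else -1) + height m w.
Proof. by rewrite /height big_cons. Qed.

Lemma height_nil : height m [::] = 0.
Proof. by rewrite /height big_nil. Qed.

Lemma height_rcons b w :
  height m (rcons w b) = height m w + (if b then m%:Z else -1).
Proof. by rewrite -cats1 height_cat height_cons height_nil addr0. Qed.

Lemma nonneg_cat h u v :
  nonneg_from h (u ++ v) <-> nonneg_from h u /\ nonneg_from (h + height m u) v.
Proof.
split=> [H|[Hu Hv] k].
  split=> k.
    case: (leqP k (size u)) => ku; first by rewrite -(takel_cat v ku); apply: H.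
    rewrite take_oversize 1?ltnW //.
    by have := H (size u); rewrite take_size_cat.
  move: (H (size u + k)%N); rewrite take_cat ltnNge leq_addr /=.
  by rewrite addKn height_cat addrA.
rewrite take_cat; case: ltnP => ku; first exact: Hu.
by rewrite height_cat addrA; apply: Hv.
Qed.

Lemma nonneg_cons h b w :
  nonneg_from h (b :: w) <->
  0 <= h /\ nonneg_from (h + (if b then m%:Z else -1)) w.
Proof.
split=> [H|[h0 H] [|k]]; last 2 first.
- by rewrite take0 height_nil addr0.
- by rewrite /= height_cons addrA; apply: H.
split; first by move: (H 0%N); rewrite take0 height_nil addr0.
by move=> k; move: (H k.+1); rewrite /= height_cons addrA.
Qed.

Lemma nonneg_nil h : nonneg_from h [::] <-> 0 <= h.
Proof.
split=> [/(_ 0%N)|h0 k]; by rewrite height_nil addr0.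
Qed.

Lemma nonneg_le h h' w : h <= h' -> nonneg_from h w -> nonneg_from h' w.
Proof. by move=> hh H k; have := H k; lia. Qed.

Lemma height_ups w : height m w = (nups w * m)%:Z - (count_mem false w)%:Z.
Proof.
elim: w => [|[] w ih]; first by rewrite height_nil.
  by rewrite height_cons ih /nups /=; lia.
by rewrite height_cons ih /nups /=; lia.
Qed.

Lemma abscissa_ups w : abscissa m w = (nups w * m + count_mem false w)%N.
Proof.
elim: w => [|[] w ih]; first by rewrite /abscissa big_nil.
  by rewrite /abscissa big_cons -/(abscissa m w) ih /nups /=; lia.
by rewrite /abscissa big_cons -/(abscissa m w) ih /nups /=; lia.
Qed.

Lemma mdyck_nups n w : (0 < m)%N -> mdyck m n w -> nups w = n.
Proof.
move=> m0 /and3P[/eqP ha /eqP hh _].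
move: ha hh; rewrite abscissa_ups height_ups => ha hh.
by apply/eqP; rewrite -(eqn_pmul2r m0); lia.
Qed.

Lemma mdyckP w :
  mdyck m (nups w) w <-> height m w = 0 /\ nonneg_from 0 w.
Proof.
split=> [/and3P[_ /eqP h0 /allP H]|[h0 H]].
  split=> // k; rewrite add0r; case: (leqP k (size w)) => kw.
    by apply: H; rewrite mem_iota /=; lia.
  by rewrite take_oversize 1?ltnW // h0.
apply/and3P; split; last 2 first.
- exact/eqP.
- by apply/allP=> k _; move: (H k); rewrite add0r.
by move: h0; rewrite abscissa_ups height_ups => h0; lia.
Qed.

Lemma down_levels_from_cat k w a :
  down_levels_from k (nseq a false ++ w) = nseq a k ++ down_levels_from k w.
Proof. by elim: a => //= a ->. Qed.

Lemma of_levels_cons a s : of_levels (a :: s) = true :: nseq a false ++ of_levels s.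
Proof. by []. Qed.

Lemma of_levels_cat s t : of_levels (s ++ t) = of_levels s ++ of_levels t.
Proof. by rewrite /of_levels map_cat flatten_cat. Qed.

Lemma nups_cat u v : nups (u ++ v) = (nups u + nups v)%N.
Proof. by rewrite /nups count_cat. Qed.

Lemma nups_of_levels s : nups (of_levels s) = size s.
Proof.
elim: s => // a s ih; rewrite of_levels_cons /= -ih /nups /= count_cat.
by rewrite count_nseq /= mul0n.
Qed.

Lemma count_of_levels k j s :
  count_mem j (down_levels_from k (of_levels s)) =
  if (k < j)%N then nth 0%N s (j - k.+1) else 0%N.
Proof.
elim: s k => [|a s ih] k; first by rewrite nth_nil /= if_same.
rewrite of_levels_cons /= down_levels_from_cat count_cat count_nseq ih /=.
case: (ltngtP k.+1 j) => kj; rewrite ?mul0n ?mul1n.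
- by rewrite -(subnSK kj).
- by [].
- by rewrite -kj subnn /= addn0.
Qed.

Lemma of_levelsK s : levels (of_levels s) = s.
Proof.
apply: (@eq_from_nth _ 0%N); rewrite size_map size_iota nups_of_levels //.
move=> i si; rewrite (nth_map 0%N) ?size_iota ?nups_of_levels //.
rewrite nth_iota //.
by rewrite /level /down_levels count_of_levels /= add1n subn1.
Qed.

Lemma of_levels_ex w : exists s, true :: w = of_levels s.
Proof.
suff [a [s ->]] : exists a s, w = nseq a false ++ of_levels s by exists (a :: s).
elim: w => [|[] w [a [s ->]]]; first by exists 0%N, [::].
- by exists 0%N, (a :: s).
- by exists a.+1, s.
Qed.

Lemma dyck_words (P : Dy m) :
  exists2 s, P = of_levels s :> seq bool & (0 < size s)%N.
Proof.
case: P => w /= /andP[w0 /mdyckP[_ H]].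
case: w w0 H => // -[] w w0 H; last first.
  by move/nonneg_cons: H => [_ /(_ 0%N)]; rewrite take0 height_nil.
have [s es] := of_levels_ex w; exists s => //.
by rewrite -nups_of_levels -es.
Qed.

Lemma levelsK (P : Dy m) : of_levels (levels P) = P.
Proof. by have [s -> _] := dyck_words P; rewrite of_levelsK. Qed.

Lemma levels_inj (P Q : Dy m) : levels P = levels Q -> P = Q.
Proof. by move=> e; apply: val_inj; rewrite /= -levelsK e levelsK. Qed.

Lemma size_levels (P : Dy m) : size (levels P) = dsize P.
Proof. by rewrite size_map size_iota. Qed.

Lemma last_levels (P : Dy m) : last 0%N (levels P) = last_level P.
Proof.
have n0 : (0 < dsize P)%N by have /andP[] := stepsP P.
rewrite -nth_last size_levels (nth_map 0%N) ?size_iota ?prednK //.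
by rewrite nth_iota ?prednK // add1n prednK.
Qed.

Lemma levels_rcons (P : Dy m) : exists2 s,
  levels P = rcons s (last_level P) & (size s).+1 = dsize P.
Proof.
have n0 : (0 < dsize P)%N by have /andP[] := stepsP P.
have := last_levels P; have := size_levels P.
case/lastP: (levels P) => [|s a]; first by move=> e; rewrite -e in n0.
by rewrite size_rcons last_rcons => e1 ->; exists s.
Qed.

Lemma of_levels_rcons s a b :
  of_levels (rcons s (a + b)%N) = of_levels (rcons s a) ++ nseq b false.
Proof.
by rewrite -!cats1 !of_levels_cat /of_levels /= !cats0 nseqD -catA.
Qed.

Lemma steps_pcat (P Q : Dy m) i : (i <= last_level P)%N ->
  exists2 u, P = u ++ nseq i false :> seq bool &
    pcat P i Q = u ++ Q ++ nseq i false :> seq bool.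
Proof.
move=> iP; have [s es _] := levels_rcons P; have [t et _] := levels_rcons Q.
have eP : P = of_levels (rcons s (last_level P - i)%N) ++ nseq i false :> seq bool.
  by rewrite -of_levels_rcons subnK // -es levelsK.
exists (of_levels (rcons s (last_level P - i)%N)) => //.
rewrite /pcat -[steps _]/(val _) insubdK.
  rewrite /cat_levels es et !size_rcons !last_rcons /= -!cats1 !take_size_cat //.
  by rewrite !cats1 of_levels_cat of_levels_rcons -et levelsK.
rewrite /cat_levels es et !size_rcons !last_rcons /= -!cats1 !take_size_cat //.
rewrite !cats1 of_levels_cat of_levels_rcons -et levelsK.
have /andP[_ /mdyckP[hP nP]] := stepsP P.
have /andP[_ /mdyckP[hQ nQ]] := stepsP Q.
set u := of_levels _ in eP *.
have hn j : height m (nseq j false) = - j%:Z.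
  by elim: j => [|j ih]; rewrite ?height_nil //= height_cons ih; lia.
rewrite eP height_cat hn in hP; move: nP; rewrite eP => /nonneg_cat[nu ni].
rewrite -topredE /=; apply/andP; split.
  by rewrite nups_cat nups_of_levels size_rcons.
apply/mdyckP; split; first by rewrite !height_cat hn hQ; lia.
apply/nonneg_cat; split=> //; apply/nonneg_cat; split.
  by apply: nonneg_le nQ; lia.
by rewrite hQ addr0.
Qed.

Lemma levels_pcat (P Q : Dy m) i : (i <= last_level P)%N ->
  levels (pcat P i Q) = cat_levels (levels P) i (levels Q).
Proof.
move=> iP; have [u eP ->] := steps_pcat Q iP.
have [s es _] := levels_rcons P; have [t et _] := levels_rcons Q.
have E : of_levels (rcons s (last_level P - i)%N) ++ nseq i false =
       u ++ nseq i false.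
  by rewrite -of_levels_rcons subnK // -es levelsK.
have sz : size (of_levels (rcons s (last_level P - i)%N)) = size u.
  by move/(congr1 size): (E); rewrite !size_cat => /addIn.
move/eqP: E; rewrite eqseq_cat //.
case/andP=> /eqP <- _; rewrite -[RHS]of_levelsK; congr (levels _).
rewrite /cat_levels es et !size_rcons !last_rcons /=.
rewrite -!cats1 !take_size_cat // !cats1 of_levels_cat of_levels_rcons -et.
by rewrite levelsK.
Qed.

Lemma last_level_pcat (P Q : Dy m) i : (i <= last_level P)%N ->
  last_level (pcat P i Q) = (last_level Q + i)%N.
Proof.
move=> iP; rewrite -!last_levels levels_pcat // /cat_levels last_cat.
by rewrite last_rcons.
Qed.

Lemma dsize_pcat (P Q : Dy m) i : (i <= last_level P)%N ->
  dsize (pcat P i Q) = (dsize P + dsize Q)%N.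
Proof.
move=> iP; have [u eP e] := steps_pcat Q iP.
by rewrite /dsize e eP !nups_cat; lia.
Qed.

Lemma dsize_star (P : Dy m) Qs ls : size ls = size Qs ->
  (sumn ls <= last_level P)%N ->
  dsize (star P Qs ls) = (dsize P + sumn [seq dsize Q | Q <- Qs])%N.
Proof.
elim: Qs ls P => [|Q Qs ih] [|l ls] P //=; first by rewrite addn0.
case=> sz lP; rewrite ih ?last_level_pcat ?dsize_pcat ?addnA //.
by rewrite leq_addl.
Qed.

Lemma steps_pcat0 (P Q : Dy m) : pcat P 0 Q = P ++ Q :> seq bool.
Proof.
by have [u -> ->] := steps_pcat Q (leq0n (last_level P)); rewrite !cats0.
Qed.

End Words.

Section Factors.
Variable m : nat.
Hypothesis m_gt0 : (0 < m)%N.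
Implicit Types (w p q u v : seq bool) (P Q R : Dy m).

Definition prime_word p : Prop :=
  [/\ p != [::], height m p = 0
    & forall k, (0 < k < size p)%N -> 0 < height m (take k p)].

Definition positive_word p : Prop :=
  forall k, (0 < k <= size p)%N -> 0 < height m (take k p).

Lemma positive_rcons b w : positive_word w -> 0 < height m (rcons w b) ->
  positive_word (rcons w b).
Proof.
move=> pw hb k /andP[k0]; rewrite size_rcons leq_eqVlt => /orP[/eqP->|].
  by rewrite -(size_rcons w b) take_size.
by rewrite ltnS => kw; rewrite -cats1 takel_cat //; apply: pw; rewrite k0.
Qed.

Lemma prime_rcons b w : positive_word w -> height m (rcons w b) = 0 ->
  prime_word (rcons w b).
Proof.
move=> pw hb; split=> //; first by case: w {pw hb}.
move=> k; rewrite size_rcons ltnS => /andP[k0 kw].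
by rewrite -cats1 takel_cat //; apply: pw; rewrite k0.
Qed.

Lemma cut_returnsP w acc (h : nat) : height m acc = h -> positive_word acc ->
  nonneg_from m h w -> h%:Z + height m w = 0 ->
  flatten (cut_returns m h acc w) = acc ++ w /\
  forall p, p \in cut_returns m h acc w -> prime_word p.
Proof.
elim: w acc h => [|s w ih] acc h ha pa /= nw hw.
  split=> //; case: acc ha pa => // b acc ha /(_ (size acc).+1).
  rewrite /= take_size; move: hw; rewrite height_nil.
  by move=> hw /(_ (leqnn _)); rewrite ha; lia.
move/nonneg_cons: nw => [_ nw]; rewrite height_cons in hw.
set h' := if s then _ else _.
have h's : h'%:Z = h%:Z + (if s then m%:Z else -1).
  rewrite /h'; case: {hw h'} s nw => nw; first by lia.
  by move: (nw 0%N); rewrite take0 height_nil; lia.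
have hr : height m (rcons acc s) = h'%:Z by rewrite height_rcons ha h's.
rewrite -h's in nw; have {}hw : h'%:Z + height m w = 0 by rewrite h's -hw addrA.
case: eqP => h'0.
  have [||||e pr] := @ih [::] 0%N; first exact: height_nil.
  - by move=> k; rewrite leqn0 => /andP[k0 /eqP e]; rewrite e in k0.
  - by move: nw; rewrite h'0.
  - by move: hw; rewrite h'0.
  split; first by rewrite /= e cat_rcons.
  move=> p; rewrite inE => /orP[/eqP->|]; last exact: pr.
  by apply: prime_rcons => //; rewrite hr h'0.
have [|||//|e pr] := ih (rcons acc s) h' => //.
  by apply: positive_rcons => //; rewrite hr; lia.
by split=> //; rewrite e cat_rcons.
Qed.

Lemma prime_nonneg p : prime_word p -> nonneg_from m 0 p.
Proof.
case=> _ h0 pos k; rewrite add0r; case: (posnP k) => [->|k0].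
  by rewrite take0 height_nil.
case: (ltnP k (size p)) => kp; first by apply/ltW/pos; rewrite k0.
by rewrite take_oversize // h0.
Qed.

Lemma prime_Dy p : prime_word p ->
  (0 < nups p)%N && mdyck m (nups p) p.
Proof.
move=> pp; have np := prime_nonneg pp; case: (pp) => p0 h0 _.
rewrite (introT idP (proj2 (mdyckP m p) (conj h0 np))) andbT.
case: p p0 {pp} h0 np => // -[] p // _ _ /nonneg_cons[_ /(_ 0%N)].
by rewrite take0 height_nil.
Qed.

Lemma steps_factors P : map (@steps m) (factors P) = cut_returns m 0 [::] P /\
  (forall R, R \in factors P -> prime_word R) /\
  flatten (map (@steps m) (factors P)) = P.
Proof.
have /andP[_ /mdyckP[hP nP]] := stepsP P.
have [|||e pr] := @cut_returnsP P [::] 0%N _ _ nP.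
- exact: height_nil.
- by move=> k; rewrite leqn0 => /andP[k0 /eqP e]; rewrite e in k0.
- by rewrite add0r.
have eF : map (@steps m) (factors P) = cut_returns m 0 [::] P.
  rewrite (pmap_filter (insubK _)); apply/all_filterP/allP => p /pr pp.
  by rewrite isSome_insub prime_Dy.
split=> //; rewrite eF; split=> // R RF; apply: pr.
by rewrite -eF map_f.
Qed.

Lemma prime_word_path P : prime_word P -> prime_path P.
Proof.
case=> _ _ pos Q R e.
have /andP[Q0 /mdyckP[hQ _]] := stepsP Q.
have /andP[R0 _] := stepsP R.
have sz (w : seq bool) : (0 < nups w)%N -> (0 < size w)%N by case: w.
have := pos (size Q); rewrite e steps_pcat0 take_size_cat // hQ.
rewrite size_cat; have := sz _ Q0; have := sz _ R0 => r0 q0.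
by rewrite ltxx q0 -{1}[size Q]addn0 ltn_add2l r0 => /(_ isT).
Qed.

Lemma steps_foldl Q (Qs : seq (Dy m)) :
  foldl (fun R Q => pcat R 0 Q) Q Qs = flatten (map (@steps m) (Q :: Qs))
    :> seq bool.
Proof.
elim/last_ind: Qs => [|Qs R ih]; first by rewrite /= cats0.
rewrite -cats1 foldl_cat /= steps_pcat0 ih /= map_cat flatten_cat /=.
by rewrite cats0 catA.
Qed.

Lemma factorsP P :
  exists Q Qs, [/\ factors P = Q :: Qs,
    P = foldl (fun R Q => pcat R 0 Q) Q Qs
    & forall R, R \in factors P -> prime_path R].
Proof.
have [_ [pr fl]] := steps_factors P.
case e: (factors P) => [|Q Qs].
  have := stepsP P; rewrite -fl e /=.
  by [].
exists Q, Qs; split=> //; last by move=> R; rewrite -e => /pr /prime_word_path.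
by apply: val_inj; rewrite /= steps_foldl -e fl.
Qed.

Lemma prime_path_word P : prime_path P -> prime_word P.
Proof.
move=> pP; have [Q [Qs [e eP _]]] := factorsP P.
have [_ [pr _]] := steps_factors P.
case/lastP: Qs e eP => [|Qs R] e eP.
  by move: (pr Q); rewrite e inE eqxx eP => /(_ isT).
by case: (pP (foldl (fun R Q => pcat R 0 Q) Q Qs) R); rewrite eP foldl_rcons.
Qed.

Lemma cut_returns_cat w acc v (h : nat) : height m acc = h ->
  prime_word (acc ++ w) -> w != [::] ->
  cut_returns m h acc (w ++ v) = (acc ++ w) :: cut_returns m 0 [::] v.
Proof.
elim: w acc h => // s w ih acc h ha pw _ /=.
have [_ _ pos] := pw; have nw := prime_nonneg pw.
set h' := if s then _ else _.
have hr : height m (rcons acc s) = h'%:Z.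
  rewrite height_rcons ha /h'; case: {h'} s pw pos nw => pw pos nw; first by lia.
  move: (nw (size acc).+1); rewrite -cat_rcons take_cat size_rcons ltnn subnn.
  by rewrite take0 cats0 height_rcons ha; lia.
case: eqP => h'0; last first.
  rewrite ih ?cat_rcons //; case: w {ih} pw pos nw => // pw _ _.
  by case: pw => _; rewrite cats1 hr => h0 _; lia.
case: w ih pw pos nw => [|s' w] ih pw pos nw; first by rewrite cats1.
have := pos (size acc).+1; rewrite -cat_rcons take_cat size_rcons ltnn subnn.
rewrite take0 cats0 hr h'0 ltxx /= size_cat size_rcons /=.
by rewrite addSn ltnS -addn1 leq_add2l => /(_ isT).
Qed.

Lemma factors_uniq Q (Qs : seq (Dy m)) :
  (forall R, R \in Q :: Qs -> prime_path R) ->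
  factors (foldl (fun R Q => pcat R 0 Q) Q Qs) = Q :: Qs.
Proof.
move=> pr; apply: (inj_map (val_inj : injective (@steps m))).
have [-> _] := steps_factors (foldl (fun R Q => pcat R 0 Q) Q Qs).
rewrite steps_foldl; elim: (Q :: Qs) pr => //= {Q Qs} Q Qs ih pr.
have pQ := prime_path_word (pr Q (mem_head _ _)).
rewrite cut_returns_cat ?height_nil //=; last by case: pQ.
by rewrite ih // => R RQs; apply: pr; rewrite inE RQs orbT.
Qed.
End Factors.

Section Coloring.
Variable m : nat.
Implicit Types (w p q u v : seq bool).

(* P_0 d P_1 d ... d P_k *)
Definition join_down (ps : seq (seq bool)) : seq bool :=
  head [::] ps ++ flatten [seq false :: p | p <- behead ps].

Lemma cut_descent_cat (h : nat) p q : nonneg_from m h p ->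
  h%:Z + height m p = 0 -> cut_descent m h (p ++ false :: q) = (p, q).
Proof.
elim: p h => [|s p ih] h np hp /=.
  by move: hp; rewrite height_nil addr0 => -[->].
move/nonneg_cons: np => [_ np]; rewrite height_cons addrA in hp.
case: s np hp => np hp; first by rewrite ih // PoszD.
case: h np hp => [|h] np hp.
  by move: (np 0%N); rewrite take0 height_nil.
have e : h.+1%:Z + -1 = h%:Z by lia.
by rewrite e in np hp; rewrite ih.
Qed.

Lemma pieces_join k (ps : seq (seq bool)) : size ps = k.+1 ->
  (forall p, p \in ps -> mdyck m (nups p) p) ->
  pieces m k (join_down ps) = ps.
Proof.
elim: k ps => [|k ih] [|p [|q ps]] //=.
  by rewrite /join_down /= cats0.
move=> [sz] dps; rewrite /join_down /=.
have /mdyckP[hp np] := dps p (mem_head _ _).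
rewrite cut_descent_cat ?add0r //; congr cons.
by apply: (ih (q :: ps)) => /= [|r rps]; rewrite ?sz // dps // inE rps orbT.
Qed.

Lemma cut_descent_size h w :
  (size (cut_descent m h w).1 <= size w)%N /\
  (size (cut_descent m h w).2 <= size w)%N.
Proof.
elim: w h => //= -[] w ih h.
  by have := ih (h + m)%N; case: cut_descent => p q /= [h1 h2]; lia.
case: h => [|h]; first by rewrite /= leqnSn.
by have := ih h; case: cut_descent => p q /= [h1 h2]; lia.
Qed.

Lemma pieces_size k w p : p \in pieces m k w -> (size p <= size w)%N.
Proof.
elim: k w => [|k ih] w /=; first by rewrite inE => /eqP->.
have [h1 h2] := cut_descent_size 0 w.
case: cut_descent h1 h2 => q r /= h1 h2; rewrite inE => /orP[/eqP->//|/ih h].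
exact: leq_trans h h2.
Qed.

Lemma coloring_rec_fuel f f' w : (size w <= f)%N -> (size w <= f')%N ->
  coloring_rec m f w = coloring_rec m f' w.
Proof.
elim: f f' w => [|f ih] [|f'] [|s w] //= sf sf'.
congr glue_colors; apply/eq_in_map => p /pieces_size sp.
by apply: ih; apply: leq_trans sp _.
Qed.

(* The defining equation of the standard coloring. *)
Lemma coloring_eq (ps : seq (seq bool)) : size ps = m.+1 ->
  (forall p, p \in ps -> mdyck m (nups p) p) ->
  coloring m (true :: join_down ps) =
  glue_colors ps [seq coloring m p | p <- ps].
Proof.
move=> sz dps; rewrite /coloring /= pieces_join //.
congr glue_colors; apply/eq_in_map => p pps; apply: coloring_rec_fuel => //.
by apply: (@pieces_size m); rewrite pieces_join.
Qed.

Lemma cut_descent_ex (h : nat) w : h%:Z + height m w < 0 ->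
  exists p q, [/\ w = p ++ false :: q, nonneg_from m h p
    & h%:Z + height m p = 0].
Proof.
elim: w h => [|s w ih] h; first by rewrite height_nil; lia.
rewrite height_cons addrA => hw.
case: s hw => hw.
  have [|p [q [-> np hp]]] := ih (h + m)%N; first by move: hw; lia.
  exists (true :: p), q; split=> //; last by rewrite height_cons -hp; lia.
  by apply/nonneg_cons; split; rewrite // -PoszD.
case: h hw => [|h] hw.
  exists [::], w; split=> //; last by rewrite height_nil.
  exact/nonneg_nil.
have [|p [q [-> np hp]]] := ih h; first by move: hw; lia.
exists (false :: p), q; split=> //; last by rewrite height_cons; lia.
by apply/nonneg_cons; split=> //; apply: nonneg_le np; lia.
Qed.

Lemma join_down_ex (k : nat) w : nonneg_from m k w -> k%:Z + height m w = 0 ->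
  exists ps, [/\ size ps = k.+1, forall p, p \in ps -> mdyck m (nups p) p
    & w = join_down ps].
Proof.
elim: k w => [|k ih] w nw hw.
  exists [:: w]; rewrite /join_down /= cats0; split=> // p; rewrite inE => /eqP->.
  by apply/mdyckP; split=> //; rewrite -hw add0r.
have [|p [q [e np hp]]] := @cut_descent_ex 0%N w; first by move: hw; lia.
rewrite e in nw hw *; move/nonneg_cat: nw => [_ /nonneg_cons[_ nq]].
rewrite height_cat height_cons in hw.
have [||ps [sz dps ->]] := ih q.
- by apply: nonneg_le nq; lia.
- by lia.
exists (p :: ps); split; first by rewrite /= sz.
  move=> r; rewrite inE => /orP[/eqP->|/dps//].
  by apply/mdyckP; split=> //; rewrite -hp add0r.
by case: ps sz {dps}.
Qed.

(* Every path of positive size has the form to which coloring_eq applies. *)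
Lemma join_down_Dy (P : Dy m) :
  exists ps, [/\ size ps = m.+1, forall p, p \in ps -> mdyck m (nups p) p
    & P = true :: join_down ps :> seq bool].
Proof.
have /andP[P0 /mdyckP[hP nP]] := stepsP P.
have [w eP] : exists w, P = true :: w :> seq bool.
  case: (steps P) P0 nP => // -[] w _; first by exists w.
  by move/nonneg_cons=> [_ /(_ 0%N)]; rewrite take0 height_nil.
rewrite eP {eP} in hP nP *; move/nonneg_cons: nP => [_].
rewrite add0r => nw; rewrite height_cons in hP.
by have [ps [sz dps ->]] := join_down_ex nw hP; exists ps.
Qed.

Lemma join_down_iota (ps : seq (seq bool)) : ps != [::] ->
  join_down ps =
  flatten [seq (if j is 0%N then [::] else [:: false]) ++ nth [::] ps j
          | j <- iota 0 (size ps)].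
Proof.
case: ps => // p ps _; rewrite /join_down /=; congr (_ ++ flatten _).
rewrite (iotaDl 1 0) -map_comp -[in LHS](mkseq_nth [::] ps) /mkseq -map_comp.
exact: eq_map.
Qed.

Lemma size_coloring w : mdyck m (nups w) w ->
  size (coloring m w) = count_mem false w.
Proof.
move: {2}(size w).+1 (ltnSn (size w)) => f; elim: f w => // f ih w sw dw.
have [->//|w0] := eqVneq w [::].
have [ps [sz dps ew]] : exists ps, [/\ size ps = m.+1,
    forall p, p \in ps -> mdyck m (nups p) p & w = true :: join_down ps].
  have P0 : (0 < nups w)%N.
    case: w w0 dw {sw} => // -[] w _ // /mdyckP[_] /nonneg_cons[_ /(_ 0%N)].
    by rewrite take0 height_nil.
  have dP : (0 < nups w)%N && mdyck m (nups w) w by rewrite P0.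
  exact: (join_down_Dy (DyPath dP)).
have ps0 : ps != [::] by rewrite -size_eq0 sz.
have sp p : p \in ps -> (size p < f)%N.
  move=> pps; move: sw; rewrite ew /= !ltnS => /(leq_trans _); apply.
  by rewrite ltnS; apply: (@pieces_size m); rewrite pieces_join.
rewrite ew coloring_eq //= join_down_iota // /glue_colors.
rewrite size_flatten /shape count_flatten -!map_comp add0n.
congr sumn; apply/eq_in_map => j; rewrite mem_iota add0n => /andP[_ jm] /=.
rewrite size_cat count_cat size_map (nth_map [::]) //; congr (_ + _)%N.
  by case: j {jm}.
by apply: ih; [apply: sp | apply: dps]; apply: mem_nth.
Qed.

Lemma size_last_colors (P : Dy m) : size (last_colors P) = last_level P.
Proof.
have /andP[_ dP] := stepsP P.
rewrite /last_colors size_mask.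
  rewrite /last_level /level count_map; apply: eq_count => k /=.
  by case: eqP.
rewrite size_map size_coloring // /down_levels.
by elim: (steps P) 0%N => //= -[] w ih k /=; rewrite ih.
Qed.
End Coloring.

(* Main.v *)
From HB Require Import structures.
Require Import Defs.
From mathcomp Require Import all_boot all_order all_algebra finmap.
From mathcomp Require Import boolp.
From mathcomp Require Import monalg.
From mathcomp Require Import zify.

Set Implicit Arguments.
Unset Strict Implicit.
Unset Printing Implicit Defensive.

Import Order.TTheory GRing.Theory Num.Theory.
Local Open Scope ring_scope.

(** The coloring of a path is a stack discipline: every up step pushes m copies
    of its rank, every down step pops one.  The word of colors of the last
    descent of P is then the whole stack after the last up step, so inserting Q
    in P before the last l down steps puts the stack of Q on top of the l
    bottom letters of the stack of P, in fresh colors.  Write mu_P(l) for the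
    largest multiplicity of a color among the last l letters ([cut_mult]).
    Inserting Q at level l thus gives a path R with mu_R(j) = mu_P(j) for
    j <= l, and mu_R(j) = max(mu_P(l), mu_Q(j - l)) for j > l.

    The product P *_i Q is a sum over the decreasing sequences
    s_1 >= ... >= s_r of levels in the last descent of P, one level for each
    prime factor of Q, such that mu_P(s_r) = i ([chains], [basis_mulE]).  The
    terms of P *_i (Q *_j R) and of (P *_k Q) *_i R are indexed by the same
    pairs of sequences: an insertion of a factor of R into P *_s Q above level
    s_r takes place in Q, and the other ones take place in P
    ([sum_chains_assoc]).  The formula for mu then turns both families of
    axioms into comparisons of integers ([dy_mul_dyck]).

    For the freeness, read the axioms as rewriting rules eliminating
    x *_i (y *_j z) for j >= i.  In any algebra, the span of the iterated
    products of a in which the right factor of a product *_i is a or a product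
    *_j with j < i is closed under all the operations ([normal_span_closed]).
    These normal monomials are parametrized by paths: to u P_0 d ... d P_m
    corresponds P_m *_m (... (P_0 *_0 a)), the operations with P_j empty being
    omitted.  So every algebra generated by a is the image of K[Dy] under a
    linear map, the evaluation of monomials.

    The algebra of paths is generated by the path with one peak
    ([peak_generates]): a larger path has the form of an insertion A x_i Q
    where the last i + 1 down steps of A have the same color (or all of them
    do, if there are only i), hence is A *_i Q minus similar terms in which
    some factors of Q have moved to A.
    Its evaluation of monomials is therefore a surjective endomorphism of
    K[Dy].  It preserves the size of paths, and there are finitely many paths
    of each size, so it is also injective.  It factors as the evaluation of
    monomials in the free algebra, which is onto, followed by the morphism to
    K[Dy]; hence that morphism is bijective. *)

(** * Linear maps and extension from a basis *)

Section LinearSums.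
Variables (K : fieldType) (U V : lmodType K) (f : U -> V).
Hypothesis f_lin : linear f.

Lemma linear_prop0 : f 0 = 0.
Proof. by have := f_lin (-1) 0 0; rewrite scaler0 addr0 scaleN1r addNr. Qed.

Lemma linear_prop_sum (I : Type) (s : seq I) (c : I -> K) (F : I -> U) :
  f (\sum_(i <- s) c i *: F i) = \sum_(i <- s) c i *: f (F i).
Proof.
elim: s => [|i s ih]; first by rewrite !big_nil linear_prop0.
by rewrite !big_cons f_lin ih.
Qed.

Lemma linear_prop_sum1 (I : Type) (s : seq I) (F : I -> U) :
  f (\sum_(i <- s) F i) = \sum_(i <- s) f (F i).
Proof.
elim: s => [|i s ih]; first by rewrite !big_nil linear_prop0.
by rewrite !big_cons -ih -{1}[F i]scale1r f_lin scale1r.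
Qed.
End LinearSums.

Section LinearExtension.
Variables (K : fieldType) (T : choiceType) (A : lmodType K) (f : T -> A).

Definition extend (z : {malg K[T]}) : A := \sum_(P <- msupp z) z@_P *: f P.

Lemma extendEw (d : {fset T}) z :
  (msupp z `<=` d)%fset -> extend z = \sum_(P <- d) z@_P *: f P.
Proof.
move=> le; rewrite /extend -(big_fset_incl _ le) // => P _ Pz.
by rewrite mcoeff_outdom // scale0r.
Qed.

Fact extend_linear : linear extend.
Proof.
move=> c x y; pose d := (msupp x `|` msupp y)%fset.
have dx : (msupp x `<=` d)%fset by apply: fsubsetUl.
have dy : (msupp y `<=` d)%fset by apply: fsubsetUr.
have dxy : (msupp (c *: x + y) `<=` d)%fset.
  apply: (fsubset_trans (msuppD_le _ _)); apply: fsetSU; exact: msuppZ_le.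
rewrite (extendEw dxy) (extendEw dx) (extendEw dy) scaler_sumr -big_split /=.
by apply: eq_bigr => P _; rewrite mcoeffD mcoeffZ scalerDl scalerA.
Qed.
HB.instance Definition _ :=
  GRing.isLinear.Build K {malg K[T]} A _ extend extend_linear.

Lemma extend_basis P : extend << P >> = f P.
Proof.
by rewrite (@extendEw [fset P]%fset) ?msuppU_le // big_seq_fset1 mcoeffUU scale1r.
Qed.
End LinearExtension.

Section LinearExtensionTheory.
Variables (K : fieldType) (T : choiceType).
Implicit Types (z : {malg K[T]}).

Lemma malg_basisE z : z = \sum_(P <- msupp z) z@_P *: << P >>.
Proof.
rewrite {1}[z]monalgE; apply: eq_bigr => P _; apply/malgP => Q.
by rewrite mcoeffZ !mcoeffU mulrnAr mulr1.
Qed.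

Lemma linear_basis_eq (A : lmodType K) (f g : {malg K[T]} -> A) :
  linear f -> linear g -> (forall P, f << P >> = g << P >>) -> f =1 g.
Proof.
move=> fl gl fg z; rewrite [z]malg_basisE.
rewrite (linear_prop_sum fl) (linear_prop_sum gl).
by apply: eq_bigr => P _; rewrite fg.
Qed.
End LinearExtensionTheory.

(** * Words of steps *)

Section Words.
Variable m : nat.
Implicit Types (p : seq bool) (P : Dy m).

Lemma height_downs j : height m (nseq j false) = - j%:Z.
Proof. by elim: j => [|j ih]; rewrite ?height_nil //= height_cons ih; lia. Qed.

Lemma take_downs j k : take k (nseq j false) = nseq (minn k j) false.
Proof. by elim: j k => [|j ih] [|k] //=; rewrite ih minnSS. Qed.

Lemma dyck_nonneg p : mdyck m (nups p) p -> nonneg_from m 0 p /\ height m p = 0.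
Proof. by move/mdyckP=> []. Qed.

Lemma dyck_nups_gt0 p : p != [::] -> mdyck m (nups p) p -> (0 < nups p)%N.
Proof.
case: p => // -[] p // _ /dyck_nonneg[/nonneg_cons[_ /(_ 0%N)]].
by rewrite take0 height_nil.
Qed.

Lemma dsize_gt0 P : (0 < dsize P)%N.
Proof. by case/andP: (stepsP P). Qed.
End Words.

(** * The coloring as a stack *)

Section Stack.
Variable m : nat.
Implicit Types (w p u v : seq bool) (s t st : seq nat).

(** The stack left by w, read with k up steps before it and the initial stack
    st; the top of the stack is its head. *)
Fixpoint stack (k : nat) st w : seq nat :=
  match w with
  | [::] => st
  | true :: w' => stack k.+1 (nseq m k.+1 ++ st) w'
  | false :: w' => stack k (behead st) w'
  end.

Fixpoint pops (k : nat) st w : seq nat :=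
  match w with
  | [::] => [::]
  | true :: w' => pops k.+1 (nseq m k.+1 ++ st) w'
  | false :: w' => head 0%N st :: pops k (behead st) w'
  end.

Lemma stack_cat k st u v :
  stack k st (u ++ v) = stack (k + nups u) (stack k st u) v.
Proof.
by elim: u k st => [|[] u ih] k st /=; rewrite ?addn0 // ih /nups /= ?addnA ?addn1.
Qed.

Lemma pops_cat k st u v :
  pops k st (u ++ v) = pops k st u ++ pops (k + nups u) (stack k st u) v.
Proof.
elim: u k st => [|[] u ih] k st /=; rewrite ?addn0 // ih /nups /= ?addnA ?addn1 //.
Qed.

Lemma size_pops k st w : size (pops k st w) = count_mem false w.
Proof. by elim: w k st => //= -[] w ih k st /=; rewrite ih. Qed.

Lemma stack_size k st w : nonneg_from m (size st) w ->
  (size (stack k st w))%:Z = (size st)%:Z + height m w.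
Proof.
elim: w k st => [|b w ih] k st; first by rewrite height_nil addr0.
move/nonneg_cons; rewrite height_cons; case: b => -[_ nw] /=.
  rewrite ih size_cat size_nseq ?PoszD; last by move: nw; rewrite addrC.
  by lia.
case: st nw => [|x st] nw /=.
  by move: (nw 0%N); rewrite take0 height_nil.
have e : (size (x :: st))%:Z + -1 = size st by rewrite /=; lia.
by rewrite e in nw; rewrite ih //=; lia.
Qed.

(** A word that never goes below its starting height never reaches the part t
    of the stack which was there before. *)
Lemma stack_frame k s t w : nonneg_from m (size s) w ->
  stack k (s ++ t) w = stack k s w ++ t /\ pops k (s ++ t) w = pops k s w.
Proof.
elim: w k s => [|b w ih] k s //=.
move/nonneg_cons; case: b => -[_ nw] /=.
  by rewrite catA; apply: ih; rewrite size_cat size_nseq PoszD addrC.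
case: s nw => [|x s] nw /=.
  by move: (nw 0%N); rewrite take0 height_nil.
have e : (size (x :: s))%:Z + -1 = size s by rewrite /=; lia.
rewrite e in nw; have [-> ->] := ih k s nw; by [].
Qed.

Lemma stack_shift a k s w : nonneg_from m (size s) w ->
  stack (k + a) (map (addn^~ a) s) w = map (addn^~ a) (stack k s w) /\
  pops (k + a) (map (addn^~ a) s) w = map (addn^~ a) (pops k s w).
Proof.
elim: w k s => [|b w ih] k s //=.
move/nonneg_cons; case: b => -[_ nw] /=.
  have [|<- <-] := ih k.+1 (nseq m k.+1 ++ s).
    by rewrite size_cat size_nseq PoszD addrC.
  by rewrite map_cat map_nseq addSn.
case: s nw => [|x s] nw /=.
  by move: (nw 0%N); rewrite take0 height_nil.
have e : (size (x :: s))%:Z + -1 = size s by rewrite /=; lia.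
rewrite e in nw; have [-> ->] := ih k s nw; by [].
Qed.

Lemma stack_dyck k st p : mdyck m (nups p) p ->
  stack k st p = st /\ pops k st p = map (addn^~ k) (pops 0 [::] p).
Proof.
move=> /dyck_nonneg[np hp].
have [e1 e2] := @stack_frame k [::] st p np.
have [/= _ e4] := @stack_shift k 0 [::] p np.
split; last by rewrite -e4 -e2.
rewrite -[LHS]/(stack k ([::] ++ st) p) e1.
have /= := @stack_size k [::] p np; rewrite hp.
by case: (stack k [::] p).
Qed.

Lemma pops_blocks k c ps : (forall p, p \in ps -> mdyck m (nups p) p) ->
  pops k (nseq (size ps) c) (flatten [seq false :: p | p <- ps]) =
  flatten [seq c :: [seq (x + (sumn [seq nups p | p <- take j ps] + k))%N
                    | x <- pops 0 [::] (nth [::] ps j)]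
          | j <- iota 0 (size ps)].
Proof.
elim: ps k => //= p ps ih k dps.
have [|e1 e2] := @stack_dyck k (nseq (size ps) c) p; first exact: dps (mem_head _ _).
rewrite pops_cat e1 e2 ih; last by move=> q qps; apply: dps; rewrite inE qps orbT.
congr (_ :: _ ++ flatten _).
rewrite (iotaDl 1 0) -[RHS]map_comp; apply: eq_map => j /=.
by congr cons; apply: eq_map => x; rewrite ?add0n; lia.
Qed.

Lemma join_down_cons p ps :
  join_down (p :: ps) = p ++ flatten [seq false :: q | q <- ps].
Proof. by []. Qed.

(** In u P_0 d P_1 ... d P_m the first up step pushes m letters 1; each path P_j
    leaves the stack unchanged and pops the letters that it pushes, whose
    ranks are shifted by the number of up steps before P_j; so the displayed
    down steps pop the letters 1.  This is the recursive definition of the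
    standard coloring. *)
Lemma coloring_pops w : mdyck m (nups w) w -> coloring m w = pops 0 [::] w.
Proof.
have [n] := ubnP (size w); elim: n w => // n ih w sw dw.
have [->//|w0] := eqVneq w [::].
have [ps [sz dps ew]] : exists ps, [/\ size ps = m.+1,
    forall p, p \in ps -> mdyck m (nups p) p & w = true :: join_down ps].
  have dP : (0 < nups w)%N && mdyck m (nups w) w by rewrite (dyck_nups_gt0 w0 dw).
  exact: (join_down_Dy (DyPath dP)).
have col p : p \in ps -> coloring m p = pops 0 [::] p.
  move=> pps; apply: ih; last exact: dps.
  move: sw; rewrite ew /= !ltnS => /(leq_ltn_trans _); apply.
  rewrite -(pieces_join sz dps) in pps; exact: pieces_size pps.
rewrite ew coloring_eq //.
case: ps sz dps col {ew} => // p ps [sz] dps col.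
have dp : mdyck m (nups p) p by apply: dps; apply: mem_head.
have dps' q : q \in ps -> mdyck m (nups q) q.
  by move=> qps; apply: dps; rewrite inE qps orbT.
have -> : pops 0 [::] (true :: join_down (p :: ps)) =
    pops 1 (nseq (size ps) 1%N) (p ++ flatten [seq false :: q | q <- ps]).
  by rewrite /= cats0 sz.
have [e1 e2] := stack_dyck 1 (nseq (size ps) 1%N) dp.
rewrite pops_cat e1 e2 pops_blocks // /glue_colors /= col ?mem_head //.
congr (_ ++ flatten _); first by apply: eq_map => x; rewrite addn0.
rewrite (iotaDl 1 0 (size ps)) -map_comp; apply/eq_in_map => j.
rewrite mem_iota add0n => /andP[_ jps] /=.
congr cons; rewrite (nth_map [::]) // col ?inE ?mem_nth ?orbT //.
by apply: eq_map => x; rewrite ?add0n; lia.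
Qed.
End Stack.

Section LastColors.
Variable m : nat.
Implicit Types (w p u v : seq bool) (s t st : seq nat) (P Q : Dy m).

Lemma stack_colors_bound k st w n :
  (forall c, c \in st -> (0 < c <= k)%N) ->
  (forall c, (count_mem c st <= m)%N) -> n = (k + nups w)%N ->
  (forall c, c \in stack m k st w -> (0 < c <= n)%N) /\
  (forall c, (count_mem c (stack m k st w) <= m)%N).
Proof.
elim: w k st n => [|b w ih] k st n cl cm /= ->; first by rewrite addn0.
case: b => /=.
  apply: ih; last by rewrite /nups /=; lia.
    move=> c; rewrite mem_cat mem_nseq => /orP[/andP[_ /eqP->]|/cl]; lia.
  move=> c; rewrite count_cat count_nseq /=.
  have [<-|_] := eqVneq k.+1 c; last by rewrite mul0n add0n.
  rewrite mul1n (_ : count_mem _ _ = 0%N) ?addn0 //.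
  by apply/count_memPn/negP => /cl; lia.
apply: ih => [c /mem_behead/cl //|c|]; last by rewrite /nups /=; lia.
by apply: leq_trans (cm c); case: (st) => //= x s; apply: leq_addl.
Qed.

Lemma down_levels_from_cat_nups k u v :
  down_levels_from k (u ++ v) =
  down_levels_from k u ++ down_levels_from (k + nups u) v.
Proof.
elim: u k => [|[] u ih] k /=; rewrite ?addn0 // ih /nups /= ?addnA ?addn1 //.
Qed.

Lemma down_levels_le k w l : l \in down_levels_from k w -> (k <= l <= k + nups w)%N.
Proof.
elim: w k => //= -[] w ih k; first by move/ih; rewrite /nups /=; lia.
by rewrite inE => /orP[/eqP->|/ih]; rewrite /nups /=; lia.
Qed.

Lemma last_peak P :
  exists v, P = rcons v true ++ nseq (last_level P) false :> seq bool.
Proof.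
have [s es _] := levels_rcons P; exists (of_levels s).
rewrite -[LHS]levelsK es -cats1 of_levels_cat -[in RHS]cats1 -catA /=.
by rewrite /of_levels /= cats0.
Qed.

(** The final descent brings the path back to the axis, so it pops the whole
    stack left after the last up step. *)
Lemma last_colors_stack P v l :
  P = rcons v true ++ nseq l false :> seq bool ->
  last_level P = l /\ last_colors P = stack m 0 [::] (rcons v true).
Proof.
move=> eP; set u := rcons v true in eP *.
have nu : nups u = (nups v).+1 by rewrite /nups /u -cats1 count_cat /= addn1.
have nP : dsize P = nups u.
  by rewrite /dsize eP nups_cat /nups count_nseq mul0n addn0.
have dl : down_levels P = down_levels_from 0 u ++ nseq l (nups u).
  rewrite /down_levels eP down_levels_from_cat_nups add0n; congr (_ ++ _).
  by elim: (l) => //= k ->.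
have lu x : x \in down_levels_from 0 u -> (x < nups u)%N.
  rewrite nu /u -cats1 down_levels_from_cat_nups /= cats0 => /down_levels_le.
  by lia.
split.
  rewrite /last_level /level dl nP count_cat count_nseq /= eqxx mul1n.
  by rewrite (count_memPn _) //; apply/negP => /lu; rewrite ltnn.
have /andP[_ dP] := stepsP P.
rewrite /last_colors dl nP map_cat coloring_pops // eP pops_cat add0n.
rewrite mask_cat; last first.
  rewrite size_map size_pops -(size_pops m 0 [::]); move: 0%N [::].
  by elim: (u) => //= -[] w ih k st /=; rewrite -ih.
rewrite (_ : map _ (down_levels_from 0 u) =
    nseq (size (down_levels_from 0 u)) false); last first.
  elim: (down_levels_from 0 u) lu => //= x xs ih lu.
  rewrite ih => [|y yxs]; last by apply: lu; rewrite inE yxs orbT.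
  by rewrite ltn_eqF // lu ?mem_head.
rewrite mask_false /= map_nseq eqxx.
move: dP => /dyck_nonneg; rewrite eP => -[/nonneg_cat[n1 _]].
have := @stack_size m 0 [::] u n1.
rewrite height_cat height_downs add0r => <-; move: (stack m 0 [::] u) => st.
move=> h; have {h} <- : size st = l by lia.
by elim: st {eP} => //= x st ->.
Qed.
Lemma last_colors_bound P :
  (forall c, c \in last_colors P -> (0 < c <= dsize P)%N) /\
  (forall c, (count_mem c (last_colors P) <= m)%N).
Proof.
have [v eP] := last_peak P; have [_ ->] := last_colors_stack eP.
apply: stack_colors_bound => //; rewrite /dsize eP nups_cat.
by rewrite /nups count_nseq mul0n addn0.
Qed.

(** The path Q pushes on the stack left by P and the l down steps that follow
    Q find the bottom of that stack again; the ranks of the up steps of Q are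
    shifted by the size of P. *)
Lemma last_colors_pcat P l Q : (l <= last_level P)%N ->
  last_colors (pcat P l Q) =
  map (addn^~ (dsize P)) (last_colors Q) ++
  drop (last_level P - l) (last_colors P).
Proof.
move=> lP; have [u eP eR] := steps_pcat Q lP.
have [v ev] := last_peak P; have [_ ->] := last_colors_stack ev.
have [w ew] := last_peak Q; have [_ ->] := last_colors_stack ew.
have eu : u = rcons v true ++ nseq (last_level P - l) false.
  have e : u ++ nseq l false =
      (rcons v true ++ nseq (last_level P - l) false) ++ nseq l false.
    by rewrite -eP -catA -nseqD subnK.
  have sz : size u = size (rcons v true ++ nseq (last_level P - l) false).
    by move/(congr1 size): (e); rewrite !size_cat => /addIn ->.
  by move/eqP: e; rewrite eqseq_cat // => /andP[/eqP].
have eR' : pcat P l Q = rcons (u ++ w) true ++ nseq (last_level Q + l) false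
    :> seq bool.
  by rewrite eR ew -!cats1 nseqD -!catA.
have [_ ->] := last_colors_stack eR'.
rewrite rcons_cat stack_cat add0n.
have nu : nups u = dsize P.
  by rewrite /dsize eP nups_cat /nups count_nseq mul0n addn0.
have /andP[_ dQ] := stepsP Q.
have [nw _] : nonneg_from m 0 (rcons w true) /\ True.
  by move/dyck_nonneg: dQ; rewrite ew => -[/nonneg_cat[]].
have [/= -> _] := @stack_frame m (nups u) [::] (stack m 0 [::] u) _ nw.
have [/= e _] := @stack_shift m (nups u) 0 [::] _ nw.
rewrite nu in e *; rewrite e; congr (_ ++ _).
rewrite eu stack_cat; move: (stack m 0 _ _) => st.
by elim: (last_level P - l)%N st => [|j ih] st /=; rewrite ?drop0 // ih; case: (st).
Qed.
End LastColors.

(** * Multiplicities of colors in the last descent *)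

Section CutMultiplicity.
Implicit Types (s t w : seq nat).

Definition maxmult w : nat := (\max_(c <- w) count_mem c w)%N.

Lemma maxmult_leP w k : reflect (forall c, count_mem c w <= k)%N (maxmult w <= k)%N.
Proof.
apply: (iffP (bigmax_leqP_seq _ _ _ _)) => h c; last by move=> *; apply: h.
by have [/h|/count_memPn ->] := boolP (c \in w); first exact.
Qed.

Lemma count_maxmult w c : (count_mem c w <= maxmult w)%N.
Proof. by move: c; apply/maxmult_leP. Qed.

Lemma maxmult_drop k w : (maxmult (drop k w) <= maxmult w)%N.
Proof.
apply/maxmult_leP => c; apply: leq_trans (count_maxmult w c).
by rewrite -{2}(cat_take_drop k w) count_cat leq_addl.
Qed.

Lemma maxmult_cat s t : (forall c, c \in s -> c \notin t) ->
  maxmult (s ++ t) = maxn (maxmult s) (maxmult t).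
Proof.
move=> st; apply/eqP; rewrite eqn_leq geq_max; apply/and3P; split.
- apply/maxmult_leP => c; rewrite count_cat.
  have [cs|/count_memPn ->] := boolP (c \in s).
    by rewrite (count_memPn (st _ cs)) addn0 leq_max count_maxmult.
  by rewrite leq_max count_maxmult orbT.
- apply/maxmult_leP => c; apply: leq_trans (count_maxmult _ c).
  by rewrite count_cat leq_addr.
- apply/maxmult_leP => c; apply: leq_trans (count_maxmult _ c).
  by rewrite count_cat leq_addl.
Qed.

Lemma maxmult_map (f : nat -> nat) w : injective f -> maxmult (map f w) = maxmult w.
Proof.
move=> fI; rewrite /maxmult big_map; apply: eq_bigr => c _.
by rewrite count_map; apply: eq_count => x /=; rewrite (inj_eq fI).
Qed.

Lemma maxmult_gt0 w : w != [::] -> (0 < maxmult w)%N.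
Proof.
case: w => // x w _; apply: leq_trans (count_maxmult _ x).
by rewrite /= eqxx.
Qed.

Lemma maxmult_nseq k c : maxmult (nseq k c) = k.
Proof.
apply/eqP; rewrite eqn_leq; apply/andP; split.
  by apply/maxmult_leP => d; rewrite count_nseq; case: (_ d); lia.
by apply: leq_trans (count_maxmult _ c); rewrite count_nseq /= eqxx mul1n.
Qed.

Lemma bounded_byE n i w : (0 < n)%N -> (forall c, c \in w -> (0 < c <= n)%N) ->
  bounded_by n i w = (maxmult w == i).
Proof.
move=> n0 wn; rewrite /bounded_by.
have iota1 c : (c \in iota 1 n) = (0 < c <= n)%N by rewrite mem_iota; lia.
have -> : all (fun c => count_mem c w <= i)%N (iota 1 n) = (maxmult w <= i)%N.
  apply/allP/maxmult_leP => [h c|h c _]; last exact: h.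
  have [/wn|/count_memPn -> //] := boolP (c \in w).
  by rewrite -iota1 => /h.
rewrite eqn_leq; case: leqP => //= le; apply/hasP/idP => [[c _ /eqP <-]|ge].
  exact: count_maxmult.
have [w0|w0] := eqVneq w [::].
  exists 1%N; first by rewrite iota1.
  by move: ge; rewrite w0 /maxmult big_nil leqn0 eq_sym.
have i0 : (0 < i)%N := leq_trans (maxmult_gt0 w0) le.
have [/hasP //|/hasPn no] := boolP (has (fun c => count_mem c w == i) (iota 1 n)).
suff : (maxmult w <= i.-1)%N by lia.
apply/maxmult_leP => c; have := leq_trans (count_maxmult w c) le.
have [/wn|/count_memPn -> //] := boolP (c \in w).
by rewrite -iota1 => /no; lia.
Qed.

Variable m : nat.
Implicit Types P Q : Dy m.

Definition cut_mult P l : nat := maxmult (drop (last_level P - l) (last_colors P)).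

Lemma cut_multE P l i :
  bounded_by (dsize P) i (drop (size (last_colors P) - l) (last_colors P)) =
  (cut_mult P l == i).
Proof.
rewrite size_last_colors bounded_byE //; first by case/andP: (stepsP P).
by move=> c /mem_drop; have [h _] := last_colors_bound P; apply: h.
Qed.

Lemma cut_mult0 P : cut_mult P 0 = 0%N.
Proof.
by rewrite /cut_mult subn0 drop_oversize ?size_last_colors // /maxmult big_nil.
Qed.

Lemma cut_mult_le P l : (cut_mult P l <= m)%N.
Proof.
apply: leq_trans (maxmult_drop _ _) _; apply/maxmult_leP.
by have [] := last_colors_bound P.
Qed.

Lemma cut_mult_mono P k l : (k <= l)%N -> (cut_mult P k <= cut_mult P l)%N.
Proof.
move=> kl; rewrite /cut_mult.
rewrite -(subnK (leq_sub2l (last_level P) kl)) -drop_drop.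
exact: maxmult_drop.
Qed.

(** The suffix of length j of the stack of P x_l Q either lies in the part coming
    from P or contains it; in the second case the colors of the two parts are
    distinct, hence the maximum. *)
Lemma cut_mult_pcat P l Q j : (l <= last_level P)%N -> (j <= last_level Q + l)%N ->
  cut_mult (pcat P l Q) j =
  if (j <= l)%N then cut_mult P j else maxn (cut_mult P l) (cut_mult Q (j - l)).
Proof.
move=> lP jQ; rewrite /cut_mult last_level_pcat // last_colors_pcat //.
rewrite drop_cat size_map size_last_colors.
case: (leqP j l) => jl.
  rewrite ifF; last by lia.
  rewrite /= drop_drop; congr (maxmult (drop _ _)); lia.
rewrite ifT; last by lia.
rewrite -map_drop maxmult_cat.
  rewrite maxnC maxmult_map; last by move=> x y /addIn.
  by congr (maxn _ (maxmult (drop _ _))); lia.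
move=> c /mapP[x /mem_drop xQ ->]; apply/negP => /mem_drop.
have [h _] := last_colors_bound P; move/h.
have [h' _] := last_colors_bound Q; move/h': xQ; lia.
Qed.
End CutMultiplicity.

(** * Insertions and prime factors *)

Section Pcat.
Variable m : nat.
Hypothesis m_gt0 : (0 < m)%N.
Implicit Types P Q R S : Dy m.

Lemma steps_pcatE P Q u i : P = u ++ nseq i false :> seq bool ->
  (i <= last_level P)%N -> pcat P i Q = u ++ Q ++ nseq i false :> seq bool.
Proof.
move=> eP iP; have [v eP' ->] := steps_pcat Q iP.
have sz : size u = size v.
  by have /(congr1 size) := eP; rewrite eP' !size_cat => /addIn ->.
by have /eqP := eP; rewrite eP' eqseq_cat // => /andP[/eqP ->].
Qed.

Lemma pcatA P s Q t R : (s <= last_level P)%N -> (t <= last_level Q)%N ->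
  pcat (pcat P s Q) (s + t) R = pcat P s (pcat Q t R).
Proof.
move=> sP tQ; apply: val_inj => /=.
have [u eP _] := steps_pcat Q sP; have [v eQ _] := steps_pcat R tQ.
have ePQ := steps_pcatE Q eP sP; have eQR := steps_pcatE R eQ tQ.
rewrite (steps_pcatE _ eP sP) eQR.
have e : pcat P s Q = (u ++ v) ++ nseq (s + t) false :> seq bool.
  by rewrite ePQ eQ addnC nseqD -!catA.
rewrite (steps_pcatE _ e) ?last_level_pcat //; last by lia.
by rewrite addnC nseqD -!catA.
Qed.

Lemma factors_cat P Q : factors (pcat P 0 Q) = factors P ++ factors Q.
Proof.
have [A [As [eA fA pA]]] := factorsP m_gt0 P.
have [B [Bs [eB fB pB]]] := factorsP m_gt0 Q.
have -> : pcat P 0 Q = foldl (fun R Q => pcat R 0 Q) A (As ++ B :: Bs).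
  apply: val_inj => /=; rewrite steps_foldl // steps_pcat0 fA fB !steps_foldl //.
  by rewrite /= map_cat flatten_cat /= -!catA.
rewrite factors_uniq ?eA ?eB //= => R.
by rewrite -cat_cons mem_cat -eA -eB => /orP[/pA|/pB].
Qed.

Lemma factors_prime P : prime_path P -> factors P = [:: P].
Proof.
move=> pP; rewrite -{1}[P]/(foldl (fun R Q => pcat R 0 Q) P [::]).
by rewrite factors_uniq // => R; rewrite inE => /eqP ->.
Qed.

Lemma mem_factors_prime P R : R \in factors P -> prime_path R.
Proof. by have [A [As [_ _]]] := factorsP m_gt0 P; apply. Qed.

(** Inserting a path at a positive level of a prime path keeps it prime: the
    inserted part stays strictly above the axis. *)
Lemma prime_pcat P t R : prime_path P -> (0 < t <= last_level P)%N ->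
  prime_path (pcat P t R).
Proof.
move=> /(prime_path_word m_gt0)[_ hP pos] /andP[t0 tP].
apply: prime_word_path.
have [u eP eR] := steps_pcat R tP.
have /andP[_ /dyck_nonneg[nR hR]] := stepsP R.
have hu : height m u = t by move: hP; rewrite eP height_cat height_downs; lia.
rewrite eR; split.
- by case: (u) hu => //=; rewrite height_nil; lia.
- by rewrite !height_cat height_downs hu hR; lia.
move=> k; rewrite !size_cat size_nseq => /andP[k0 kl].
rewrite take_cat; case: ltnP => ku.
  have := pos k; rewrite eP take_cat ku size_cat size_nseq; apply; lia.
rewrite height_cat hu take_cat; case: ltnP => kR.
  by have := nR (k - size u)%N; rewrite add0r; lia.
by rewrite height_cat hR take_downs height_downs; lia.
Qed.

(** An insertion at a positive level takes place inside the last prime factor. *)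
Lemma factors_rcons P : exists As B, [/\ factors P = rcons As B,
    last_level B = last_level P
  & forall t R, (0 < t <= last_level P)%N ->
      factors (pcat P t R) = rcons As (pcat B t R)].
Proof.
have [A [As [eA fA pA]]] := factorsP m_gt0 P.
case/lastP: As eA fA => [|As B] eA fA.
  exists [::], P; rewrite eA fA; split=> //= t R tP.
  by apply/factors_prime/prime_pcat => //; apply: pA; rewrite eA mem_head.
have pB : prime_path B by apply: pA; rewrite eA inE mem_rcons mem_head orbT.
set S := foldl (fun R Q => pcat R 0 Q) A As.
have eP : P = pcat S 0 B by rewrite fA -cats1 foldl_cat.
have eS : factors S = A :: As.
  rewrite factors_uniq // => R RA; apply: pA; rewrite eA.
  by move: RA; rewrite !inE mem_rcons inE => /orP[->|->] //; rewrite !orbT.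
have lB : last_level B = last_level P by rewrite eP last_level_pcat // addn0.
exists (A :: As), B; split=> // t R tP.
rewrite -lB in tP; have /andP[_ tB] := tP.
rewrite eP -{1}[t]add0n pcatA // factors_cat eS.
by rewrite (factors_prime (prime_pcat pB tP)) cats1.
Qed.
End Pcat.

(** * Decreasing sequences of insertions *)

Section Chains.
Variable m : nat.
Hypothesis m_gt0 : (0 < m)%N.
Implicit Types (P Q R S : Dy m) (Ps Qs Rs : seq (Dy m)).

(** The results P' of the insertions of the paths Qs in P at levels
    b >= s_1 >= ... >= s_r, each paired with its last level s_r: the last level
    decides to which products P' contributes. *)
Fixpoint chains P (b : nat) Qs : seq (nat * Dy m) :=
  if Qs is Q :: Qs' then
    flatten [seq chains (pcat P s Q) s Qs' | s <- iota 0 b.+1]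
  else [:: (b, P)].

Lemma chains_cons P b Q Qs : chains P b (Q :: Qs) =
  flatten [seq chains (pcat P s Q) s Qs | s <- iota 0 b.+1].
Proof. by []. Qed.

Section Sums.
Variables (V : nmodType) (F : nat -> Dy m -> V).

Lemma sum_chains_cons P b Q Qs :
  \sum_(x <- chains P b (Q :: Qs)) F x.1 x.2 =
  \sum_(s <- iota 0 b.+1) \sum_(x <- chains (pcat P s Q) s Qs) F x.1 x.2.
Proof. by rewrite chains_cons big_flatten big_map. Qed.
End Sums.

Lemma sum_chains_cat (V : nmodType) (F : nat -> Dy m -> V) P b Qs Rs :
  \sum_(x <- chains P b (Qs ++ Rs)) F x.1 x.2 =
  \sum_(x <- chains P b Qs) \sum_(y <- chains x.2 x.1 Rs) F y.1 y.2.
Proof.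
elim: Qs P b => [|Q Qs ih] P b; first by rewrite big_seq1.
rewrite (sum_chains_cons (fun s S => \sum_(y <- chains S s Rs) F y.1 y.2)).
by rewrite sum_chains_cons; apply: eq_bigr => s _; rewrite ih.
Qed.

Lemma sum_chains_rcons (V : nmodType) (F : nat -> Dy m -> V) P b Qs R :
  \sum_(x <- chains P b (rcons Qs R)) F x.1 x.2 =
  \sum_(x <- chains P b Qs) \sum_(s <- iota 0 x.1.+1) F s (pcat x.2 s R).
Proof.
rewrite -cats1 sum_chains_cat; apply: eq_bigr => x _.
by rewrite sum_chains_cons; apply: eq_bigr => s _; rewrite big_seq1.
Qed.

Lemma mem_chains_cons P b Q Qs x :
  reflect (exists2 s, (s <= b)%N & x \in chains (pcat P s Q) s Qs)
          (x \in chains P b (Q :: Qs)).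
Proof.
apply: (iffP flatten_mapP) => -[s sb xs]; exists s => //.
  by move: sb; rewrite mem_iota add0n ltnS.
by rewrite mem_iota add0n ltnS.
Qed.

(** Levels decrease, so the last x.1 down steps of P keep their place, hence
    their colors, at the end of every result. *)
Lemma chains_inv P b Qs x : (b <= last_level P)%N -> x \in chains P b Qs ->
  [/\ (x.1 <= b)%N, (x.1 <= last_level x.2)%N,
      dsize x.2 = (dsize P + sumn [seq dsize Q | Q <- Qs])%N
    & forall j, (j <= x.1)%N -> cut_mult x.2 j = cut_mult P j].
Proof.
elim: Qs P b => [|Q Qs ih] P b bP.
  by rewrite inE => /eqP -> /=; split; rewrite ?addn0.
case/mem_chains_cons => s sb xs.
have sP := leq_trans sb bP.
have [|h1 h2 h3 h4] := ih _ _ _ xs; first by rewrite last_level_pcat // leq_addl.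
split=> [||/=|j jx]; rewrite ?h2 ?(leq_trans h1 sb) //.
  by rewrite h3 dsize_pcat // addnA.
rewrite h4 // cut_mult_pcat //; last first.
  by rewrite (leq_trans jx) // (leq_trans h1) // leq_addl.
by rewrite (leq_trans jx h1).
Qed.

Lemma sum_dsize_factors Q : sumn [seq dsize R | R <- factors Q] = dsize Q.
Proof.
have [A [As [eA fA pA]]] := factorsP m_gt0 Q.
have [_ [_ fl]] := steps_factors m_gt0 Q.
rewrite /dsize -[in RHS]fl; elim: (factors Q) => //= S Ss ->.
by rewrite nups_cat.
Qed.

Lemma cut_mult_last_factor Q Qs R j : factors Q = rcons Qs R ->
  last_level R = last_level Q /\
  ((j <= last_level Q)%N -> cut_mult Q j = cut_mult R j).
Proof.
have [A [As [eA fA _]]] := factorsP m_gt0 Q; rewrite eA.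
case/lastP: As eA fA => [|As B] eA fA.
  by case: Qs => [|? []] //= [<-]; rewrite fA.
rewrite -rcons_cons => /rcons_inj[_ <-]; rewrite fA -cats1 foldl_cat /=.
rewrite last_level_pcat // addn0; split=> // jB.
rewrite cut_mult_pcat ?addn0 // leqn0 cut_mult0 max0n subn0.
by case: eqP => // ->; rewrite !cut_mult0.
Qed.

Lemma chains_factors_inv P b Q x :
    (b <= last_level P)%N -> x \in chains P b (factors Q) ->
  [/\ (x.1 <= b)%N, last_level x.2 = (last_level Q + x.1)%N,
      dsize x.2 = (dsize P + dsize Q)%N
    & forall j, (j <= last_level Q + x.1)%N -> cut_mult x.2 j =
        if (j <= x.1)%N then cut_mult P j
        else maxn (cut_mult P x.1) (cut_mult Q (j - x.1))].
Proof.
move=> bP xs; have [h1 _ h3 h4] := chains_inv bP xs.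
have [As [B [eQ lB _]]] := factors_rcons m_gt0 Q.
rewrite -(sum_dsize_factors Q) h3.
suff [y [yL yM ->]] : exists y, [/\ (x.1 <= last_level y)%N,
    forall j, (j <= x.1)%N -> cut_mult y j = cut_mult P j
  & x.2 = pcat y x.1 B].
  rewrite last_level_pcat // lB; split=> // j jl.
  rewrite cut_mult_pcat ?lB //; case: leqP => [/yM // | xj].
  have [_ ->] := cut_mult_last_factor (j - x.1) eQ; last by rewrite leq_subLR addnC.
  by rewrite yM.
move: xs {h1 h3 h4}; rewrite eQ; elim: As P b bP {eQ} => [|A As ih] P b bP.
  case/mem_chains_cons => s sb; rewrite inE => /eqP ->.
  by exists P; split=> //=; apply: leq_trans bP.
case/mem_chains_cons => s sb xs; have sP := leq_trans sb bP.
have bA : (s <= last_level (pcat P s A))%N by rewrite last_level_pcat // leq_addl.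
have [h1 _ _ h4] := chains_inv bA xs.
have [y [yL yM e]] := ih _ _ bA xs; exists y; split=> // j jx; rewrite yM //.
by rewrite cut_mult_pcat ?(leq_trans jx) ?(leq_trans h1) ?leq_addl.
Qed.

(** Inserting Q x_t R amounts to inserting Q and then R, t levels above the level
    where the last factor of Q was put. *)
Lemma sum_chains_pcat (V : nmodType) (F : nat -> Dy m -> V) P b Q t R :
    (b <= last_level P)%N -> (0 < t <= last_level Q)%N ->
  \sum_(x <- chains P b (factors (pcat Q t R))) F x.1 x.2 =
  \sum_(x <- chains P b (factors Q)) F x.1 (pcat x.2 (x.1 + t) R).
Proof.
move=> bP tQ; have [As [B [eQ lB fB]]] := factors_rcons m_gt0 Q.
rewrite fB // eQ (sum_chains_rcons F).
rewrite (sum_chains_rcons (fun s S => F s (pcat S (s + t) R))).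
apply: eq_big_seq => x /(chains_inv bP)[h1 h2 _ _].
apply: eq_big_seq => s; rewrite mem_iota add0n ltnS => sx.
by rewrite pcatA ?lB ?(leq_trans sx) //; case/andP: tQ.
Qed.

(** Both sides sum over the same iterated insertions.  On the left, R_1, ..., R_t
    are inserted in Q at levels s_1 >= ... >= s_t, and then the result in P.  The
    R_k with s_k > 0 disappear in the last factor of the result, while those
    with s_k = 0 become new factors, with a level in P of their own.  On the
    right, with Q inserted in P up to the level y.1, the former have the level
    y.1 + s_k > y.1, and the latter a level at most y.1.  By induction on Rs,
    the term s = 0 on the left gives the terms s <= y.1 on the right. *)
Theorem sum_chains_assoc (V : nmodType) (G : nat -> nat -> Dy m -> V) P b Q c Rs :
    (b <= last_level P)%N -> (c <= last_level Q)%N ->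
    (forall R, R \in Rs -> prime_path R) ->
  \sum_(x <- chains Q c Rs)
    \sum_(y <- chains P b (factors x.2)) G x.1 y.1 y.2 =
  \sum_(y <- chains P b (factors Q))
    \sum_(x <- chains y.2 (y.1 + c) Rs)
      (if (y.1 < x.1)%N then G (x.1 - y.1)%N y.1 x.2 else G 0%N x.1 x.2).
Proof.
move=> bP; elim: Rs Q c => [|R Rs ih] Q c cQ pR.
  rewrite big_seq1 /=; apply: eq_bigr => y _; rewrite big_seq1 /=.
  case: c {cQ} => [|c]; first by rewrite addn0 ltnn.
  by rewrite ifT ?addKn //; lia.
pose K t s T := if (t < s)%N then G (s - t)%N t T else G 0%N s T.
have pRs S : S \in Rs -> prime_path S by move=> SR; apply: pR; rewrite inE SR orbT.
rewrite (sum_chains_cons (fun s S => \sum_(y <- chains P b (factors S)) G s y.1 y.2)).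
transitivity (\sum_(y <- chains P b (factors Q))
    (\sum_(s <- iota 0 y.1.+1) \sum_(x <- chains (pcat y.2 s R) s Rs) K y.1 x.1 x.2 +
     \sum_(s <- iota 1 c) \sum_(x <- chains (pcat y.2 (y.1 + s) R) (y.1 + s) Rs)
       K y.1 x.1 x.2)); last first.
  apply: eq_bigr => y _; rewrite (sum_chains_cons (K y.1)).
  rewrite -addSn iotaD big_cat /= add0n; congr (_ + _).
  by rewrite -[y.1.+1]addn1 iotaDl big_map.
(* Insertions of R at a positive level, which take place inside Q. *)
rewrite big_split /= big_cons; congr (_ + _); last first.
  rewrite exchange_big /=; apply: eq_big_seq => s; rewrite mem_iota => /andP[s1 s2].
  have sQ : (s <= last_level Q)%N by lia.
  rewrite ih ?last_level_pcat ?leq_addl //.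
  rewrite (sum_chains_pcat (fun t S => \sum_(x <- chains S (t + s) Rs) K t x.1 x.2)) //.
  by rewrite s1.
(* The insertion at level 0, which makes R a new prime factor. *)
rewrite ih // factors_cat // (factors_prime m_gt0 (pR R (mem_head _ _))).
rewrite (sum_chains_cat (fun t S => \sum_(x <- chains S (t + 0) Rs) K t x.1 x.2)).
apply: eq_big_seq => y /(chains_factors_inv bP)[_ lY _ _].
rewrite (sum_chains_cons (fun t S => \sum_(x <- chains S (t + 0) Rs) K t x.1 x.2)).
apply: eq_big_seq => s; rewrite mem_iota add0n ltnS => sy; rewrite big_seq1 /= addn0.
apply: eq_big_seq => x /chains_inv[|xs _ _ _].
  by rewrite last_level_pcat ?leq_addl // lY; apply: leq_trans sy (leq_addl _ _).
by rewrite /K !ltnNge xs (leq_trans xs) //; case/andP: sy.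
Qed.
End Chains.

(** * The product as a sum over insertions *)

Section ProductAsChains.
Variable m : nat.
Implicit Types (P Q : Dy m) (Qs : seq (Dy m)) (ls : seq nat).

(** The lists (lambda_1, ..., lambda_r) of sum at most b, enumerated by their sum
    s: the head is what remains of s. *)
Fixpoint tails (r b : nat) : seq (seq nat) :=
  if r is r'.+1 then
    [seq (s - sumn ls)%N :: ls | s <- iota 0 b.+1, ls <- tails r' s]
  else [:: [::]].

Lemma tailsS r b : tails r.+1 b =
  [seq (s - sumn ls)%N :: ls | s <- iota 0 b.+1, ls <- tails r s].
Proof. by []. Qed.

Lemma mem_tails r b ls : (ls \in tails r b) = (size ls == r) && (sumn ls <= b)%N.
Proof.
elim: r b ls => [|r ih] b ls.
  by rewrite inE; case: ls.
rewrite tailsS; apply/allpairsPdep/andP => [[s [ls' [sb]]]|].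
  rewrite ih mem_iota in sb * => /andP[/eqP <- le] -> /=.
  by split=> //; lia.
case: ls => [|l ls] [] // sz le; exists (l + sumn ls)%N, ls.
by split; rewrite ?addnK ?mem_iota ?add0n ?ltnS ?ih ?leq_addl ?andbT.
Qed.

Lemma uniq_tails r b : uniq (tails r b).
Proof.
elim: r b => [|r ih] b //; rewrite tailsS.
apply: allpairs_uniq_dep => [|s _|]; rewrite ?iota_uniq //.
pose pair_of (p : {_ : nat & seq nat}) := (tag p, tagged p : seq nat).
move=> [s ls] [s' ls'] /allpairsPdep[x [y [_ h e]]] /allpairsPdep[x' [y' [_ h' e']]].
move=> /= [e1 e2]; rewrite e2 in e e1 *.
have [es el] : s = x /\ ls' = y by case: (congr1 pair_of e).
have [es' el'] : s' = x' /\ ls' = y' by case: (congr1 pair_of e').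
move: h h'; rewrite -es -el -es' -el' !mem_tails => /andP[_ l1] /andP[_ l2].
by rewrite -(subnK l1) -(subnK l2) e1.
Qed.

Lemma chains_tails P b Qs :
  chains P b Qs = [seq (last b ls, star P Qs ls) | ls <- tails (size Qs) b].
Proof.
elim: Qs P b => // Q Qs ih P b.
rewrite chains_cons tailsS map_flatten -map_comp; congr flatten.
apply: eq_map => s /=; rewrite ih -map_comp; apply/eq_in_map => ls.
rewrite mem_tails => /andP[_ le] /=; rewrite subnK //.
by case: ls le => //=; rewrite subn0.
Qed.

Section Compositions.
Variables (P : Dy m) (r : nat).
Implicit Types l : {ffun 'I_r.+1 -> 'I_(last_level P).+1}.

Let full l : seq nat := [seq val (l j) | j <- enum 'I_r.+1].

Let tail l : seq nat := behead (full l).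

Lemma size_full l : size (full l) = r.+1.
Proof. by rewrite size_map size_enum_ord. Qed.

Lemma nth_full l (j : 'I_r.+1) : nth 0%N (full l) j = l j.
Proof. by rewrite (nth_map ord0) ?size_enum_ord // nth_ord_enum. Qed.

Lemma full_Lambda l : l \in Lambda P r ->
  exists x, full l = x :: tail l /\ (x + sumn (tail l) = last_level P)%N.
Proof.
rewrite inE => /eqP <-; have := size_full l; rewrite /tail.
have -> : (\sum_j l j = sumn (full l))%N by rewrite sumnE big_map big_enum.
by case: (full l) => //= x s _; exists x.
Qed.

Lemma last_full l : l \in Lambda P r -> val (l ord_max) = last (last_level P) (tail l).
Proof.
move=> lL; have [x [e s]] := full_Lambda lL.
have := nth_last 0%N (full l); rewrite size_full /= -[r]/(val (@ord_max r)) nth_full.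
move=> ->; rewrite e; case: (tail l) s {e} => //=.
by rewrite addn0.
Qed.

(** A composition of L(P) is determined by its entries after the first one. *)
Lemma tails_Lambda (c : nat -> bool) :
  perm_eq [seq tail l | l <- enum [set l in Lambda P r | c (l ord_max)]]
    [seq ls <- tails r (last_level P) | c (last (last_level P) ls)].
Proof.
apply: uniq_perm.
- rewrite map_inj_in_uniq ?enum_uniq // => l l'.
  rewrite !mem_enum => /[!inE] /andP[h _] /andP[h' _] e.
  have [|x [e1 s1]] := @full_Lambda l; first by rewrite inE.
  have [|x' [e2 s2]] := @full_Lambda l'; first by rewrite inE.
  have ee : full l = full l'.
    by rewrite e1 e2 -e; congr cons; move: s1 s2; rewrite e; lia.
  by apply/ffunP => j; apply: val_inj; rewrite /= -!nth_full ee.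
- by rewrite filter_uniq // uniq_tails.
move=> ls; rewrite mem_filter mem_tails; apply/mapP/and3P.
  case=> l; rewrite mem_enum inE => /andP[lL cl] ->.
  rewrite -last_full //; have [x [e s]] := full_Lambda lL; split=> //.
    by have := size_full l; rewrite e /= => -[->].
  by rewrite -s leq_addl.
case=> cl /eqP sz le; pose fl := (last_level P - sumn ls)%N :: ls.
have sfl : sumn fl = last_level P by rewrite /= subnK.
have nfl (j : nat) : (nth 0%N fl j < (last_level P).+1)%N.
  rewrite ltnS -sfl; elim: (fl) j => [|y s ih] [|j] //=; first exact: leq_addr.
  by apply: leq_trans (ih j) _; apply: leq_addl.
pose l : {ffun 'I_r.+1 -> 'I_(last_level P).+1} :=
  [ffun j : 'I_r.+1 => Ordinal (nfl j)].
have el : full l = fl.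
  apply: (@eq_from_nth _ 0%N); rewrite size_full ?[RHS]/= ?sz // => j jr.
  by rewrite -[j]/(val (Ordinal jr)) nth_full ffunE.
have tl : tail l = ls by rewrite /tail el.
have lL : l \in Lambda P r.
  rewrite inE; have -> : (\sum_j l j = sumn (full l))%N.
    by rewrite sumnE big_map big_enum.
  by rewrite el sfl.
exists l => //; rewrite mem_enum inE lL /=.
by rewrite -[nat_of_ord _]/(val (l ord_max)) last_full // tl.
Qed.
End Compositions.

Variable K : fieldType.

Lemma basis_mulE (i : nat) P Q :
  basis_mul K i P Q =
  \sum_(x <- chains P (last_level P) (factors Q))
    (if cut_mult P x.1 == i then << x.2 >> else 0).
Proof.
rewrite -big_mkcond chains_tails big_map /= -big_filter.
rewrite -(perm_big _ (tails_Lambda P _ (fun s => cut_mult P s == i))) /=.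
rewrite big_map big_enum; apply: eq_bigl => l.
by rewrite !inE cut_multE.
Qed.
End ProductAsChains.

(** * The axioms *)

Section MultiplicityComparison.
Local Open Scope nat_scope.
Implicit Types i j p q r : nat.

(* Below, p, q and r stand for the multiplicities mu_P(t), mu_Q(s - t) and
   mu_P(s), where t is the last level in P of the factors of Q and s that of
   the factors of R. *)

Lemma nested_lt i j p q : i < j ->
  (q == j) && (p == i) = (p == i) && (maxn p q == j).
Proof. by move=> ij; apply/andP/andP => -[/eqP h1 /eqP h2]; split; apply/eqP; lia. Qed.

Lemma nested_lt_low i j p r : i < j -> r <= p ->
  (0 == j) && (r == i) = (p == i) && (r == j).
Proof. by move=> ij rp; apply/andP/andP => -[/eqP h1 /eqP h2]; exfalso; lia. Qed.

Lemma nested_sum i p q : (q <= i) && (p == i) = (i <= p) && (maxn p q == i).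
Proof. by apply/andP/andP => -[h1 /eqP h2]; split; try apply/eqP; lia. Qed.

Lemma nested_sum_low i p r : r <= p ->
  (0 <= i) && (r == i) = (i <= p) && (r == i).
Proof. by move=> rp; apply/andP/andP => -[h1 /eqP h2]; split; try apply/eqP; lia. Qed.
End MultiplicityComparison.

Section DyckAlgebra.
Variables (K : fieldType) (m : nat).
Hypothesis m_gt0 : (0 < m)%N.
Implicit Types (P Q R : Dy m) (i j k : 'I_m.+1) (x y z : {malg K[Dy m]}).

Lemma dy_mulE i x y :
  dy_mul i x y = extend (fun P => extend (basis_mul K i P) y) x.
Proof.
rewrite /dy_mul /extend; apply: eq_bigr => P _; rewrite scaler_sumr.
by apply: eq_bigr => Q _; rewrite scalerA.
Qed.

Lemma dy_mul_linearr i x : linear (dy_mul i x).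
Proof.
move=> c y z; rewrite !dy_mulE /extend scaler_sumr -big_split /=.
apply: eq_bigr => P _; rewrite -/(extend _ (c *: y + z)) linearP scalerDr.
by rewrite !scalerA mulrC.
Qed.

Lemma dy_mul_linearl i y : linear (fun x => dy_mul i x y).
Proof. by move=> c x z; rewrite !dy_mulE linearP. Qed.

Lemma dy_mul_basis i P Q : dy_mul i << P >> << Q >> = basis_mul K i P Q.
Proof. by rewrite dy_mulE !extend_basis. Qed.

Lemma sum_if b (I : eqType) (s : seq I) (c : I -> bool) (F : I -> {malg K[Dy m]}) :
  (if b then \sum_(u <- s) (if c u then F u else 0) else 0) =
  \sum_(u <- s) (if b && c u then F u else 0).
Proof. by case: b => //=; rewrite big1. Qed.

(** The common form of the two products of three paths, by [sum_chains_assoc];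
    the condition c selects the pairs of last levels which contribute. *)
Let double_chains P Q R (c : nat -> nat -> bool) : {malg K[Dy m]} :=
  \sum_(y <- chains P (last_level P) (factors Q))
    \sum_(x <- chains y.2 (y.1 + last_level Q) (factors R))
      (if c y.1 x.1 then << x.2 >> else 0).

Lemma mul_right_nested i j P Q R :
  dy_mul i << P >> (dy_mul j << Q >> << R >>) = double_chains P Q R (fun t s =>
    if (t < s)%N then (cut_mult Q (s - t) == j) && (cut_mult P t == i)
    else (0%N == j) && (cut_mult P s == i)).
Proof.
rewrite dy_mul_basis basis_mulE (linear_prop_sum1 (dy_mul_linearr _ _)).
under eq_bigr do rewrite (fun_if (dy_mul i _)) (linear_prop0 (dy_mul_linearr _ _))
  dy_mul_basis basis_mulE sum_if.
rewrite (sum_chains_assoc m_gt0 (fun s t S => if (cut_mult Q s == j) &&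
  (cut_mult P t == i) then << S >> else 0)) //; last first.
  exact: mem_factors_prime.
apply: eq_bigr => y _; apply: eq_bigr => x _.
by rewrite cut_mult0; case: ifP.
Qed.

Lemma mul_left_nested k i P Q R :
  dy_mul i (dy_mul k << P >> << Q >>) << R >> = double_chains P Q R (fun t s =>
    (cut_mult P t == k) && ((if (s <= t)%N then cut_mult P s
      else maxn (cut_mult P t) (cut_mult Q (s - t))) == i)).
Proof.
rewrite dy_mul_basis basis_mulE (linear_prop_sum1 (dy_mul_linearl _ _)).
under eq_bigr do rewrite (fun_if (fun x => dy_mul i x _))
  (linear_prop0 (dy_mul_linearl _ _)) dy_mul_basis basis_mulE sum_if.
apply: eq_big_seq => y /(chains_factors_inv m_gt0 (leqnn _))[_ lY _ mY].
rewrite lY addnC; apply: eq_big_seq => x /chains_inv[|xs _ _ _].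
  by rewrite lY addnC.
by rewrite mY // addnC.
Qed.

Lemma eq_double_chains P Q R c d :
  c =2 d -> double_chains P Q R c = double_chains P Q R d.
Proof. by move=> cd; apply: eq_bigr => y _; apply: eq_bigr => x _; rewrite cd. Qed.

(** For given t and s, only the index j = f t s can contribute. *)
Lemma sum_double_chains P Q R (p : pred 'I_m.+1) (q : pred nat)
    (f : nat -> nat -> nat) (b : nat -> nat -> bool) :
  (forall i : 'I_m.+1, p i = q i) -> (forall t s, f t s <= m)%N ->
  \sum_(j | p j) double_chains P Q R (fun t s => (f t s == j) && b t s) =
  double_chains P Q R (fun t s => q (f t s) && b t s).
Proof.
move=> pq fm; rewrite /double_chains exchange_big; apply: eq_bigr => y _ /=.
rewrite exchange_big; apply: eq_bigr => x _ /=.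
case: (b _ _); last by rewrite andbF big1 // => j _; rewrite andbF.
rewrite andbT; under eq_bigr do rewrite andbT.
rewrite -big_mkcondr; set a := f _ _.
have am : (a < m.+1)%N by rewrite ltnS fm.
case: ifP => qa; last first.
  by rewrite big_pred0 // => j; apply: contraFF qa; rewrite pq => /andP[qj /eqP ->].
rewrite (big_pred1 (Ordinal am)) // => j /=; rewrite pq -val_eqE /= eq_sym.
by case: eqP => [->|]; rewrite ?qa ?andbF.
Qed.

Theorem dy_mul_dyck : dyck_algebra (@dy_mul K m).
Proof.
have lr := dy_mul_linearr; have ll := dy_mul_linearl.
split; [exact: lr | exact: ll | move=> i j x y z ij | move=> i x y z].
  move: x; apply: linear_basis_eq => [||P].
  - by move=> c u v; rewrite ll.
  - by move=> c u v; rewrite !ll.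
  move: y; apply: linear_basis_eq => [||Q].
  - by move=> c u v; rewrite ll lr.
  - by move=> c u v; rewrite lr ll.
  move: z; apply: linear_basis_eq => [||R].
  - by move=> c u v; rewrite !lr.
  - by move=> c u v; rewrite lr.
  rewrite mul_right_nested mul_left_nested; apply: eq_double_chains => t s.
  case: (ltnP t s) => ts; first exact: nested_lt.
  exact/nested_lt_low/cut_mult_mono.
have sumlin (p : pred 'I_m.+1) (F : 'I_m.+1 -> {malg K[Dy m]} -> {malg K[Dy m]}) :
    (forall j, linear (F j)) -> linear (fun u => \sum_(j | p j) F j u).
  move=> lF c u v; rewrite scaler_sumr -big_split; apply: eq_bigr => j _.
  exact: lF.
move: x; apply: linear_basis_eq => [||P].
- by apply: sumlin => j c u v; rewrite ll.
- by apply: sumlin => j c u v; rewrite !ll.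
move: y; apply: linear_basis_eq => [||Q].
- by apply: sumlin => j c u v; rewrite ll lr.
- by apply: sumlin => j c u v; rewrite lr ll.
move: z; apply: linear_basis_eq => [||R].
- by apply: sumlin => j c u v; rewrite !lr.
- by apply: sumlin => j c u v; rewrite lr.
under eq_bigr do rewrite mul_right_nested.
under [RHS]eq_bigr do rewrite mul_left_nested.
rewrite (sum_double_chains P Q R (q := fun a => (i <= a)%N)) //; last first.
  by move=> t s; apply: cut_mult_le.
pose f t s := if (t < s)%N then cut_mult Q (s - t) else 0%N.
pose b t s := cut_mult P (if (t < s)%N then t else s) == i.
transitivity (\sum_(j < m.+1 | (j <= i)%N)
    double_chains P Q R (fun t s => (f t s == j) && b t s)).
  apply: eq_bigr => j _; apply: eq_double_chains => t s.
  by rewrite /f /b; case: ifP.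
rewrite (sum_double_chains P Q R b (q := fun a => (a <= i)%N)) //; last first.
  by move=> t s; rewrite /f; case: ifP => // _; apply: cut_mult_le.
apply: eq_double_chains => t s; rewrite /f /b.
case: (ltnP t s) => st; first exact: nested_sum.
exact/nested_sum_low/cut_mult_mono.
Qed.
End DyckAlgebra.

(** * Generation by the path with one peak *)

Section Generation.
Variable m : nat.
Implicit Types (P Q R A : Dy m) (Qs : seq (Dy m)).

Fact peak_subproof :
  (0 < nups (true :: nseq m false))%N &&
  mdyck m (nups (true :: nseq m false)) (true :: nseq m false).
Proof.
apply/andP; split=> //; apply/mdyckP.
rewrite height_cons height_downs; split; first by lia.
by apply/nonneg_cons; split=> // k; rewrite take_downs height_downs; lia.
Qed.
Definition peak : Dy m := DyPath peak_subproof.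

Hypothesis m_gt0 : (0 < m)%N.

Lemma word_last_up w : (0 < nups w)%N ->
  exists v k, w = rcons v true ++ nseq k false.
Proof.
elim/last_ind: w => // w [] ih; first by exists w, 0%N; rewrite cats0.
rewrite -cats1 nups_cat addn0 => /ih[v [k ->]].
by exists v, k.+1; rewrite -catA -[k.+1]addn1 nseqD.
Qed.

Lemma peak_or_pcat P :
  P = peak \/ exists A l, (l <= last_level A)%N /\ P = pcat A l peak.
Proof.
have [v eP] := last_peak P.
have /andP[_ /dyck_nonneg[nP hP]] := stepsP P.
rewrite eP height_cat height_rcons height_downs in hP.
move: nP; rewrite eP -cats1 -catA => /nonneg_cat[nv _].
have hv : 0 <= height m v.
  by have := nv (size v); rewrite take_size add0r.
have [v0|v_gt0] := posnP (nups v).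
  have v0' : v = [::].
    case: v v0 nv {eP hP hv} => // -[] // v _ /nonneg_cons[_ /(_ 0%N)].
    by rewrite take0 height_nil.
  left; apply: val_inj; rewrite /= eP v0' /=; congr (_ :: nseq _ _).
  by move: hP; rewrite v0' height_nil; lia.
right; have [l el] : exists l : nat, last_level P = (m + l)%N.
  by exists (last_level P - m)%N; lia.
have hA : height m v = l by move: hP; rewrite el; lia.
have dA : (0 < nups (v ++ nseq l false))%N &&
    mdyck m (nups (v ++ nseq l false)) (v ++ nseq l false).
  apply/andP; split; first by rewrite nups_cat ltn_addr.
  apply/mdyckP; rewrite height_cat height_downs hA subrr.
  split=> //; apply/nonneg_cat; split=> // k.
  by rewrite hA add0r take_downs height_downs; lia.
have [w [k ew]] := word_last_up v_gt0.
have lA : last_level (DyPath dA) = (k + l)%N.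
  have [] // := @last_colors_stack _ (DyPath dA) w (k + l).
  by rewrite /= {1}ew nseqD catA.
exists (DyPath dA), l; rewrite lA leq_addl; split=> //.
apply: val_inj => /=; rewrite (@steps_pcatE _ _ _ v) ?lA ?leq_addl //.
by rewrite eP el nseqD -cats1 -!catA.
Qed.

(** The last i + 1 down steps of A (or all of them, if there are only i) have the
    same color.  Then i is the only level l with mu_A(l) = i. *)
Definition isolated A i : Prop :=
  (i <= last_level A)%N /\
  forall l, (l <= i.+1)%N -> (l <= last_level A)%N -> cut_mult A l = l.

Lemma isolated_cut A i l : isolated A i -> (l <= last_level A)%N ->
  (cut_mult A l == i) = (l == i).
Proof.
move=> [iA h] lA; case: (leqP l i.+1) => li; first by rewrite h.
have := cut_mult_mono A (ltnW li); rewrite h //; last first.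
  by apply: leq_trans lA; apply: ltnW.
by move=> c; apply/eqP/eqP; lia.
Qed.

Lemma isolated_le_m A i : isolated A i -> (i <= m)%N.
Proof. by move=> [iA h]; rewrite -(h i) // cut_mult_le. Qed.

Lemma isolated_pcat A i l Q : isolated A i -> (i < l <= last_level A)%N ->
  isolated (pcat A l Q) i.
Proof.
move=> [iA h] /andP[il lA]; split; first by rewrite last_level_pcat //; lia.
move=> j ji; rewrite last_level_pcat // => jL.
by rewrite cut_mult_pcat // (leq_trans ji) // h //; lia.
Qed.

Lemma last_colors_peak : last_level peak = m /\ last_colors peak = nseq m 1%N.
Proof.
have [] := @last_colors_stack _ peak [::] m (erefl _).
by rewrite /= cats0.
Qed.

Lemma isolated_peak l : (l <= m)%N -> isolated peak l.
Proof.
have [L lc] := last_colors_peak.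
move=> lm; split; rewrite L // => j _ jm.
by rewrite /cut_mult L lc drop_nseq maxmult_nseq subKn.
Qed.

(** By induction, removing the last peak: P is A x_l peak.  If A is B x_i Q with i
    isolated, then the peak can be added to Q when l >= i; when l < i, the last
    i down steps of A are those of B, so l is isolated in A. *)
Lemma isolated_decomposition P :
  P = peak \/ exists A i Q, isolated A i /\ P = pcat A i Q.
Proof.
have [n] := ubnP (dsize P); elim: n P => // n ih P Pn.
have [->|[A [l [lA eP]]]] := peak_or_pcat P; [by left | right].
have An : (dsize A < n)%N.
  by move: Pn; rewrite eP dsize_pcat // -ltnS; have := dsize_gt0 peak; lia.
have [eA|[B [i [Q [iso eA]]]]] := ih A An.
  exists A, l, peak; split=> //; rewrite eA; apply: isolated_peak.
  by have [lp _] := last_colors_peak; rewrite eA lp in lA.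
have [iB h] := iso.
have [il|li] := leqP i l.
  exists B, i, (pcat Q (l - i) peak); split=> //.
  rewrite -pcatA ?subnKC -?eA //.
  by rewrite leq_subLR addnC; move: lA; rewrite eA last_level_pcat.
exists A, l, peak; split=> //; split=> // j jl jA.
rewrite eA cut_mult_pcat //; last by rewrite -(last_level_pcat Q iB) -eA.
by rewrite (leq_trans jl li) h //; lia.
Qed.

Section Closure.
Variables (K : fieldType) (G : {malg K[Dy m]} -> Prop).
Hypotheses (G_lin : forall c x y, G x -> G y -> G (c *: x + y))
  (G_mul : forall i x y, G x -> G y -> G (dy_mul i x y))
  (G_peak : G << peak >>).

Let G0 : G 0.
Proof. by have := G_lin (-1) G_peak G_peak; rewrite scaleN1r addNr. Qed.

Let G_sum (I : eqType) (s : seq I) (F : I -> {malg K[Dy m]}) :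
  (forall u, u \in s -> G (F u)) -> G (\sum_(u <- s) F u).
Proof.
move=> GF; rewrite big_seq; elim/big_rec: _ => // u x us Gx.
by rewrite -[F u]scale1r; apply: G_lin => //; apply: GF.
Qed.

Section Step.
Variables (n i : nat).
Hypothesis ih : forall P, (dsize P < n)%N -> G << P >>.

Let sum_ending A b Qs : {malg K[Dy m]} :=
  \sum_(x <- chains A b Qs) (if x.1 == i then << x.2 >> else 0).

(** For b = L(A) the sum is a product.  Lowering b removes sums of the same form
    in which the first factor Q has been inserted in A at a level s > b, where i
    is still isolated. *)
Lemma closed_chains Qs A b : isolated A i -> (i <= b <= last_level A)%N ->
  (dsize A + sumn [seq dsize Q | Q <- Qs])%N = n ->
  (forall Q, Q \in Qs -> prime_path Q) -> Qs != [::] -> G (sum_ending A b Qs).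
Proof.
elim: Qs A b => // Q Qs IH A b isoA /andP[ib bA] sz pQ _.
have smaller s : (i < s <= last_level A)%N -> G (sum_ending (pcat A s Q) s Qs).
  case/andP => si sA; case: Qs IH sz pQ => [|Q' Qs] IH sz pQ.
    by rewrite /sum_ending big_seq1 /= gtn_eqF.
  apply: IH => //.
  - by apply: isolated_pcat; rewrite ?si.
  - by rewrite last_level_pcat // leq_addl ltnW.
  - by rewrite dsize_pcat // -addnA.
  - by move=> R RQ; apply: pQ; rewrite inE RQ orbT.
have split_at c : sum_ending A c (Q :: Qs) =
    \sum_(s <- iota 0 c.+1) sum_ending (pcat A s Q) s Qs.
  exact: (sum_chains_cons (fun s S => if s == i then << S >> else 0)).
have -> : sum_ending A b (Q :: Qs) = sum_ending A (last_level A) (Q :: Qs) -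
    \sum_(s <- iota b.+1 (last_level A - b)) sum_ending (pcat A s Q) s Qs.
  rewrite !split_at (_ : (last_level A).+1 = b.+1 + (last_level A - b))%N; last by lia.
  by rewrite iotaD big_cat /= add0n addrK.
rewrite addrC -scaleN1r; apply: G_lin.
  apply: G_sum => s; rewrite mem_iota => sb; apply: smaller; lia.
pose S := foldl (fun R Q => pcat R 0 Q) Q Qs.
have fS : factors S = Q :: Qs by apply: factors_uniq.
have im := isolated_le_m isoA.
have -> : sum_ending A (last_level A) (Q :: Qs) =
    dy_mul (Ordinal (im : (i < m.+1)%N)) << A >> << S >>.
  rewrite dy_mul_basis basis_mulE fS.
  apply: eq_big_seq => x /(chains_inv (leqnn _))[xA _ _ _].
  by rewrite (isolated_cut isoA xA).
have dS : dsize S = sumn [seq dsize Q | Q <- Q :: Qs] by rewrite -fS sum_dsize_factors.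
by apply: G_mul; apply: ih; rewrite -sz -dS;
  have := dsize_gt0 S; have := dsize_gt0 A; lia.
Qed.

(** When the levels are bounded by i, ending at i leaves only one choice. *)
Lemma chains_constant (V : nmodType) (F : Dy m -> V) Qs A : (i <= last_level A)%N ->
  \sum_(x <- chains A i Qs) (if x.1 == i then F x.2 else 0) =
  F (foldl (fun R Q => pcat R i Q) A Qs).
Proof.
elim: Qs A => [|Q Qs IH] A iA; first by rewrite big_seq1 /= eqxx.
rewrite (sum_chains_cons (fun s S => if s == i then F S else 0)).
rewrite -addn1 iotaD big_cat /= big_seq1 add0n [X in X + _]big1_seq ?add0r.
  by rewrite IH // last_level_pcat // leq_addl.
move=> s /=; rewrite mem_iota add0n => /andP[_ si]; apply: big1_seq => x.
case/andP=> _ /chains_inv[|xs _ _ _].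
  by rewrite last_level_pcat ?leq_addl //; lia.
by rewrite ltn_eqF // (leq_ltn_trans xs).
Qed.

Lemma foldl_pcat Qs A Q : (i <= last_level A)%N ->
  foldl (fun R Q => pcat R i Q) A (Q :: Qs) =
  pcat A i (foldl (fun R Q => pcat R 0 Q) Q Qs).
Proof.
move=> iA /=; elim: Qs Q => //= R Qs IH Q.
by rewrite -IH -pcatA // addn0.
Qed.

Lemma closed_pcat A Q : isolated A i -> (dsize A + dsize Q)%N = n ->
  G << pcat A i Q >>.
Proof.
move=> isoA sz; have [iA _] := isoA.
have [B [Bs [eB fB pB]]] := factorsP m_gt0 Q.
rewrite fB -foldl_pcat // -eB -(chains_constant (fun S => << S >>)) //.
apply: closed_chains => //; rewrite ?leqnn ?iA ?eB //.
by rewrite -eB sum_dsize_factors.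
Qed.
End Step.

Theorem peak_generates z : G z.
Proof.
suff GP P : G << P >>.
  rewrite [z]malg_basisE; apply: G_sum => P _.
  by rewrite -[_ *: _]addr0; apply: G_lin.
have [n] := ubnP (dsize P); elim: n P => // n ih P Pn.
have [->//|[A [i [Q [iso eP]]]]] := isolated_decomposition P.
have [iA _] := iso; rewrite eP; apply: closed_pcat (erefl _) => // R Rn.
by apply: ih; move: Pn; rewrite eP dsize_pcat //; lia.
Qed.
End Closure.
End Generation.

(** * Normal monomials *)

Section NormalSpan.
Variables (m : nat) (K : fieldType) (A : lmodType K).
Variables (op : 'I_m.+1 -> A -> A -> A) (a : A).

(** The span of the normal monomials a and x *_i y with i < n, where the right
    factor y is a or a product *_j with j < i. *)
Inductive normal_span : nat -> A -> Prop :=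
  | normal_gen : normal_span 0 a
  | normal_lin n c x y :
      normal_span n x -> normal_span n y -> normal_span n (c *: x + y)
  | normal_weaken n x : normal_span n x -> normal_span n.+1 x
  | normal_op (i : 'I_m.+1) x y :
      normal_span m.+1 x -> normal_span i y -> normal_span i.+1 (op i x y).

Lemma normal_span_le n k x : (n <= k)%N -> normal_span n x -> normal_span k x.
Proof.
move/subnKC <-; elim: (k - n)%N => [|j ih] xn; first by rewrite addn0.
by rewrite addnS; apply/normal_weaken/ih.
Qed.

Lemma normal_span0 n : normal_span n 0.
Proof.
have g := normal_span_le (leq0n n) normal_gen.
by have := normal_lin (-1) g g; rewrite scaleN1r addNr.
Qed.

Lemma normal_spanD n x y :
  normal_span n x -> normal_span n y -> normal_span n (x + y).
Proof. by move=> xn yn; rewrite -[x]scale1r; apply: normal_lin. Qed.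

Lemma normal_span_sum n (I : finType) (p : pred I) (F : I -> A) :
  (forall i, p i -> normal_span n (F i)) -> normal_span n (\sum_(i | p i) F i).
Proof.
move=> h; apply: big_ind => //; [exact: normal_span0 | exact: normal_spanD].
Qed.

Hypothesis dA : dyck_algebra op.

(** Let y = y1 *_i y2 be normal.  A product x *_j y is normal for j > i; for j < i
    the first axiom gives (x *_j y1) *_i y2; for j = i the second axiom expresses
    it with the (x *_k y1) *_i y2 for k >= i and the x *_i (y1 *_k y2) for k < i,
    where y1 *_k y2 is a combination of normal monomials in which all the outer
    operations are below i. *)
Lemma normal_span_mul n x y (j : 'I_m.+1) : normal_span n y ->
  normal_span m.+1 x -> (j < n)%N -> normal_span n (op j x y).
Proof.
have [lr _ ax1 ax2] := dA.
move=> yn; elim: yn x j => {n y} [|n c y z _ ihy _ ihz|n y yn ih|i y z yn ihy zn ihz]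
  x j xn jn.
- by [].
- by rewrite lr; apply: normal_lin; [apply: ihy | apply: ihz].
- move: jn; rewrite ltnS leq_eqVlt => /orP[/eqP jn|jn].
    by rewrite -jn; apply: normal_op; rewrite // jn.
  exact/normal_weaken/ih.
move: jn; rewrite ltnS leq_eqVlt => /orP[/eqP/val_inj ->|ji]; last first.
  by rewrite ax1 //; apply: normal_op => //; apply: ihy.
have := ax2 i x y z; rewrite (bigD1 i) //= => /(canRL (addrK _)) ->.
rewrite -scaleN1r addrC; apply: normal_lin; apply: normal_span_sum => k.
  case/andP=> ki kne; apply: normal_op => //; apply: ihz => //.
  by rewrite ltn_neqAle ki andbT.
by move=> ik; apply: normal_op => //; apply: ihy.
Qed.

Lemma normal_span_closed (j : 'I_m.+1) x y :
  normal_span m.+1 x -> normal_span m.+1 y -> normal_span m.+1 (op j x y).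
Proof. by move=> xn yn; apply: normal_span_mul. Qed.
End NormalSpan.

(** * Monomials indexed by paths *)

Section Monomials.
Variables (m : nat) (K : fieldType) (A : lmodType K).
Variables (op : 'I_m.+1 -> A -> A -> A) (a : A).
Implicit Types (w p : seq bool) (ps : seq (seq bool)) (P Q R : Dy m).

(** P_(k-1) *_(k-1) (... (P_0 *_0 a)), where the P_j are evaluated by f and the
    empty ones are omitted. *)
Definition graft (f : seq bool -> A) ps (k : nat) : A :=
  iteri k (fun j y => if nth [::] ps j is [::] then y
                      else op (inord j) (f (nth [::] ps j)) y) a.

Fixpoint monomial_rec fuel w : A :=
  match fuel, w with
  | fuel'.+1, _ :: w' => graft (monomial_rec fuel') (pieces m m w') m.+1
  | _, _ => a
  end.

Lemma monomial_recS fuel b w : monomial_rec fuel.+1 (b :: w) =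
  graft (monomial_rec fuel) (pieces m m w) m.+1.
Proof. by []. Qed.

Definition monomial w : A := monomial_rec (size w) w.

Lemma eq_graft (f g : seq bool -> A) ps qs k :
  (forall j, (j < k)%N -> nth [::] ps j = nth [::] qs j) ->
  (forall p, p \in ps -> f p = g p) -> graft f ps k = graft g qs k.
Proof.
move=> pq fg; elim: k pq => //= k ih pq.
rewrite /graft /= -!/(graft _ _ _) ih; last by move=> j jk; apply/pq/ltnW.
rewrite -pq //; case e: (nth _ _ _) => [//|b p].
by rewrite -e fg // mem_nth // ltnNge; apply/negP => /(nth_default [::]); rewrite e.
Qed.

Lemma monomial_rec_fuel f f' w : (size w <= f)%N -> (size w <= f')%N ->
  monomial_rec f w = monomial_rec f' w.
Proof.
elim: f f' w => [|f ih] [|f'] [|s w] // sf sf'.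
rewrite !monomial_recS; apply: eq_graft => // p /pieces_size sp.
by apply: ih; apply: leq_trans sp _.
Qed.

Lemma monomial_join ps : size ps = m.+1 ->
  (forall p, p \in ps -> mdyck m (nups p) p) ->
  monomial (true :: join_down ps) = graft monomial ps m.+1.
Proof.
move=> sz dps; rewrite /monomial monomial_recS pieces_join //.
apply: eq_graft => // p pps; apply: monomial_rec_fuel => //.
by apply: (@pieces_size m m); rewrite pieces_join.
Qed.

Lemma graftS f ps k : graft f ps k.+1 =
  if nth [::] ps k is [::] then graft f ps k
  else op (inord k) (f (nth [::] ps k)) (graft f ps k).
Proof. by []. Qed.

Lemma graft_trivial f ps k n : (k <= n)%N ->
  (forall j, (k <= j)%N -> nth [::] ps j = [::]) -> graft f ps n = graft f ps k.
Proof.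
move/subnKC <-; elim: (n - k)%N => [|d ih] triv; first by rewrite addn0.
by rewrite addnS graftS triv ?leq_addr // ih.
Qed.

(** The paths whose monomials span the step n of [normal_span]. *)
Definition pieces_below n P : Prop :=
  exists ps, [/\ size ps = m.+1, forall p, p \in ps -> mdyck m (nups p) p,
    P = true :: join_down ps :> seq bool
    & forall j, (n <= j)%N -> nth [::] ps j = [::]].

Lemma join_down_path ps : size ps = m.+1 ->
  (forall p, p \in ps -> mdyck m (nups p) p) ->
  exists P : Dy m, P = true :: join_down ps :> seq bool.
Proof.
move=> sz dps.
have h (k : nat) qs : size qs = k.+1 -> (forall p, p \in qs -> mdyck m (nups p) p) ->
    nonneg_from m k (join_down qs) /\ k%:Z + height m (join_down qs) = 0.
  elim: k qs => [|k ih] [|p [|q qs]] //= szq dqs.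
    rewrite /join_down /= cats0.
    by have /dyck_nonneg[np ->] := dqs p (mem_head _ _).
  have /dyck_nonneg[np hp] := dqs p (mem_head _ _).
  have [||n1 n2] := ih (q :: qs); rewrite /= ?(succn_inj szq) //.
    by move=> r rqs; apply: dqs; rewrite inE rqs orbT.
  have -> : join_down [:: p, q & qs] = p ++ false :: join_down (q :: qs) by [].
  have e : k.+1%:Z + -1 = k by lia.
  rewrite height_cat height_cons hp; split; last by lia.
  apply/nonneg_cat; split; first by apply: nonneg_le np; lia.
  by rewrite hp addr0; apply/nonneg_cons; rewrite e; split.
have [nj hj] := h m ps sz dps.
have d : (0 < nups (true :: join_down ps))%N &&
    mdyck m (nups (true :: join_down ps)) (true :: join_down ps).
  apply/andP; split=> //; apply/mdyckP; rewrite height_cons; split=> //.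
  by apply/nonneg_cons; rewrite add0r.
by exists (DyPath d).
Qed.

Lemma pieces_below_peak (P := peak m) : pieces_below 0 P /\ monomial P = a.
Proof.
have e : peak m = true :: join_down (nseq m.+1 [::]) :> seq bool.
  rewrite /= /join_down /=; congr cons.
  by elim: (m) => //= k <-.
have t j : nth [::] (nseq m.+1 [::]) j = [::] :> seq bool.
  by rewrite nth_nseq if_same.
have d p : p \in nseq m.+1 [::] -> mdyck m (nups p) p.
  rewrite mem_nseq => /andP[_ /eqP ->].
  by apply/mdyckP; split; [exact: height_nil | apply/nonneg_nil].
split; first by exists (nseq m.+1 [::]); rewrite size_nseq; split.
rewrite /P e monomial_join ?size_nseq //.
by rewrite (@graft_trivial _ _ 0 m.+1).
Qed.

(** The monomial on the right is that of Q with its empty piece Q_i replaced by P. *)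
Lemma monomial_op (i : 'I_m.+1) P Q : pieces_below i Q ->
  exists2 R, pieces_below i.+1 R & monomial R = op i (monomial P) (monomial Q).
Proof.
case=> ps [sz dps eQ triv].
pose qs := set_nth [::] ps i (steps P).
have qsE j : nth [::] qs j = if j == i then steps P else nth [::] ps j.
  exact: nth_set_nth.
have sq : size qs = m.+1 by rewrite size_set_nth sz; apply/maxn_idPr.
have /andP[P0 dP] := stepsP P.
have dqs p : p \in qs -> mdyck m (nups p) p.
  case/(nthP [::]) => j; rewrite sq qsE => jm <-.
  by case: eqP => // _; apply: dps; rewrite mem_nth ?sz.
have [R eR] := join_down_path sq dqs.
exists R.
  exists qs; split=> // j ij; rewrite qsE gtn_eqF //.
  by apply: triv; apply: ltnW.
rewrite eR eQ !monomial_join // (@graft_trivial _ qs i.+1) //; last first.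
  by move=> j ij; rewrite qsE gtn_eqF //; apply/triv/ltnW.
rewrite (@graft_trivial _ ps i m.+1) //; last exact: ltnW.
rewrite graftS qsE eqxx inord_val.
have -> : graft monomial qs i = graft monomial ps i.
  by apply: eq_graft => // j ji; rewrite qsE ltn_eqF.
by case: (steps P) P0.
Qed.

Hypothesis dA : dyck_algebra op.

Definition monomial_ev : {malg K[Dy m]} -> A := extend (fun P : Dy m => monomial P).

Let image n y : Prop := exists2 z, y = monomial_ev z &
  forall P, P \in msupp z -> pieces_below n P.

Lemma image_lin n c x y : image n x -> image n y -> image n (c *: x + y).
Proof.
case=> u -> un [v -> vn]; exists (c *: u + v); first by rewrite /monomial_ev linearP.
move=> P /(fsubsetP (msuppD_le _ _)); rewrite in_fsetU => /orP[]; last exact: vn.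
by move/(fsubsetP (msuppZ_le _ _))/un.
Qed.

Lemma image_basis n P : pieces_below n P -> image n (monomial P).
Proof.
move=> Pn; exists << P >>; first by rewrite /monomial_ev extend_basis.
by move=> Q /(fsubsetP msuppU_le); rewrite in_fset1 => /eqP ->.
Qed.

Lemma image_sum n (s : seq (Dy m)) (c : Dy m -> K) (F : Dy m -> A) :
  (forall P, P \in s -> image n (F P)) -> image n (\sum_(P <- s) c P *: F P).
Proof.
elim: s => [_|P s ih h].
  rewrite big_nil; exists 0; first by rewrite /monomial_ev linear0.
  by move=> P; rewrite msupp0 in_fset0.
rewrite big_cons; apply: image_lin; first by apply: h; rewrite mem_head.
by apply: ih => Q Qs; apply: h; rewrite inE Qs orbT.
Qed.

Lemma normal_span_image n y : normal_span op a n y -> image n y.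
Proof.
have [lr ll _ _] := dA.
elim=> {n y} [|n c x y _ ihx _ ihy|n x _ [z -> h]|i x y _ [u -> un] _ [v -> vn]].
- have [b e] := pieces_below_peak; rewrite -e; exact: image_basis.
- exact: image_lin.
- exists z => // P /h [ps [sz dps e t]]; exists ps; split=> // j nj.
  by apply: t; apply: ltnW.
rewrite /monomial_ev /extend (linear_prop_sum (ll i _)).
apply: image_sum => P _; rewrite (linear_prop_sum (lr i _)).
apply: image_sum => Q /vn Qi.
by have [R Ri <-] := monomial_op P Qi; apply: image_basis.
Qed.
End Monomials.

Lemma monomial_morph (m : nat) (K : fieldType) (A B : lmodType K)
    (opA : 'I_m.+1 -> A -> A -> A) (opB : 'I_m.+1 -> B -> B -> B)
    (f : A -> B) (a : A) w :
  op_morphism opA opB f -> f (monomial opA a w) = monomial opB (f a) w.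
Proof.
move=> fM; rewrite /monomial; move: (size w) => n; elim: n w => [|n ih] [|b w] //.
rewrite !monomial_recS; elim: (m.+1) => // k ihk; rewrite !graftS.
by case e: (nth _ _ _) => [|b' p] //; rewrite fM ih ihk.
Qed.

(** * Grading and bijectivity *)

Section Grading.
Variables (m : nat) (K : fieldType).
Hypothesis m_gt0 : (0 < m)%N.
Implicit Types (P Q R : Dy m) (x y z : {malg K[Dy m]}).

Definition homogeneous (n : nat) z : Prop :=
  forall R, dsize R <> n -> z@_R = 0.

Lemma homogeneous_sum n (I : eqType) (s : seq I) (F : I -> {malg K[Dy m]}) :
  (forall i, i \in s -> homogeneous n (F i)) -> homogeneous n (\sum_(i <- s) F i).
Proof.
move=> h R Rn; rewrite raddf_sum big_seq; apply: big1 => i si; exact: h.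
Qed.

Lemma homogeneous_supp n z P : homogeneous n z -> P \in msupp z -> dsize P = n.
Proof.
move=> h; rewrite -mcoeff_neq0; have [//|/eqP/h ->] := eqVneq (dsize P) n.
by rewrite eqxx.
Qed.

Lemma homogeneous_basis P : homogeneous (dsize P) << P >>.
Proof.
by move=> R RP; rewrite mcoeffU; case: eqP => // e; case: RP; rewrite e.
Qed.

Lemma homogeneous_mul (i : 'I_m.+1) a b x y :
  homogeneous a x -> homogeneous b y -> homogeneous (a + b) (dy_mul i x y).
Proof.
move=> hx hy; apply: homogeneous_sum => P /(homogeneous_supp hx) Pa.
apply: homogeneous_sum => Q /(homogeneous_supp hy) Qb R Rn.
rewrite mcoeffZ basis_mulE (_ : mcoeff R _ = 0) ?mulr0 //.
apply: homogeneous_sum Rn => u /(chains_factors_inv m_gt0 (leqnn _))[_ _ su _].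
case: ifP => _; last by move=> R' _; rewrite mcoeff0.
by rewrite -Pa -Qb -su; apply: homogeneous_basis.
Qed.

Lemma nups_join_down ps : nups (join_down ps) = sumn [seq nups p | p <- ps].
Proof.
case: ps => //= p ps; rewrite join_down_cons nups_cat; congr (_ + _)%N.
by elim: ps => //= q ps <-; rewrite nups_cat.
Qed.

(** The peak counts for the first up step u, and the pieces P_j for the others. *)
Lemma homogeneous_monomial P :
  homogeneous (dsize P) (monomial (@dy_mul K m) << peak m >> P).
Proof.
have [n] := ubnP (size P); elim: n P => // n ih P sP.
have [ps [sz dps eP]] := join_down_Dy P.
rewrite /dsize [in homogeneous _]eP eP monomial_join //.
have sub j : (j < m.+1)%N -> nth [::] ps j != [::] ->
    homogeneous (nups (nth [::] ps j))
      (monomial (@dy_mul K m) << peak m >> (nth [::] ps j)).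
  move=> jm p0; have pps : nth [::] ps j \in ps by rewrite mem_nth ?sz.
  set p := nth _ _ _ in p0 pps *; have dp := dps p pps.
  have d : (0 < nups p)%N && mdyck m (nups p) p by rewrite (dyck_nups_gt0 p0 dp).
  apply: (ih (DyPath d)); move: sP; rewrite eP /= !ltnS => /(leq_trans _); apply.
  by rewrite ltnS; apply: (@pieces_size m m); rewrite pieces_join.
have -> : nups (true :: join_down ps) =
    (sumn [seq nups p | p <- take m.+1 ps]).+1.
  by rewrite -sz take_size -nups_join_down.
suff graded k : (k <= m.+1)%N ->
    homogeneous (sumn [seq nups p | p <- take k ps]).+1
      (graft (@dy_mul K m) << peak m >> (monomial (@dy_mul K m) << peak m >>) ps k).
  exact: graded.
elim: k => [_|k ihk km].
  have -> : (sumn [seq nups p | p <- take 0 ps]).+1 = dsize (peak m).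
    by rewrite take0 /dsize /nups /= count_nseq.
  exact: homogeneous_basis.
rewrite graftS (take_nth [::]) ?sz // map_rcons sumn_rcons.
have hk := ihk (ltnW km).
case e: (nth [::] ps k) => [|b p]; first by rewrite addn0.
rewrite -e -addSn addnC; apply: homogeneous_mul => //.
by apply: sub; rewrite ?e.
Qed.

Definition paths_of_size n : seq (Dy m) :=
  undup [seq P <- pmap insub [seq val t | t : (n * m.+1).-tuple bool]
        | dsize P == n].

Lemma mem_paths_of_size n P : (P \in paths_of_size n) = (dsize P == n).
Proof.
rewrite mem_undup mem_filter; case: eqP => //= Pn.
rewrite mem_pmap_sub; apply/mapP.
have /andP[_ /mdyckP[hP _]] := stepsP P.
have sP : size P == (n * m.+1)%N.
  have := count_predC id P.
  rewrite (@eq_count _ (predC id) (pred1 false)); last by case.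
  rewrite (@eq_count _ id (pred1 true)); last by case.
  rewrite -/(nups P) -/(dsize P) Pn => <-.
  move: hP; rewrite height_ups -/(dsize P) Pn mulnS => /eqP.
  by rewrite subr_eq0 => /eqP[->].
by exists (Tuple sP); rewrite ?mem_enum.
Qed.

Section GradedEndomorphism.
Variable f : Dy m -> {malg K[Dy m]}.
Hypothesis f_graded : forall P, homogeneous (dsize P) (f P).

Lemma coeff_extend n R z : dsize R = n ->
  (extend f z)@_R = \sum_(P <- paths_of_size n) z@_P * (f P)@_R.
Proof.
move=> Rn; pose d := (msupp z `|` [fset P in paths_of_size n])%fset.
have zd : (msupp z `<=` d)%fset by apply: fsubsetUl.
rewrite (extendEw f zd) raddf_sum /=.
under eq_bigr do rewrite mcoeffZ.
rewrite (bigID (fun P => dsize P == n)) /= [X in _ + X]big1 ?addr0; last first.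
  move=> P /eqP Pn; rewrite f_graded ?mulr0 // => e; apply: Pn; by rewrite -e.
rewrite -big_filter; apply: perm_big; apply: uniq_perm.
- by rewrite filter_uniq // fset_uniq.
- exact: undup_uniq.
move=> P; rewrite mem_filter mem_paths_of_size in_fsetU inE /= mem_paths_of_size.
by case: eqP => //; rewrite orbT.
Qed.

(** In each degree f is an endomorphism of a finite-dimensional space, for
    which surjectivity and injectivity are equivalent. *)
Lemma graded_injective : (forall y, exists z, extend f z = y) ->
  forall z, extend f z = 0 -> z = 0.
Proof.
move=> surj z fz; apply/malgP => R; rewrite mcoeff0.
pose s := paths_of_size (dsize R); pose N := size s.
pose e (i : 'I_N) : Dy m := nth R s i.
have es i : dsize (e i) = dsize R.
  by apply/eqP; rewrite -mem_paths_of_size mem_nth.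
have coeff (i : 'I_N) u : (extend f u)@_(e i) =
    \sum_(j < N) u@_(e j) * (f (e j))@_(e i).
  by rewrite (@coeff_extend (dsize R)) // (big_nth R) big_mkord.
have [g gE] := choice (fun i : 'I_N => surj << e i >>).
pose M := \matrix_(j < N, i < N) (f (e j))@_(e i).
pose L := \matrix_(i < N, j < N) (g i)@_(e j).
(* Row i of L lists the coordinates of a preimage of the i-th path. *)
have LM : L *m M = 1%:M.
  apply/matrixP => i k; rewrite !mxE.
  under eq_bigr do rewrite !mxE.
  rewrite -coeff gE mcoeffU; congr (_ *+ _).
  by rewrite /e nth_uniq ?undup_uniq.
have ML := mulmx1C LM.
pose v := \row_(j < N) z@_(e j).
have v0 : v = 0.
  rewrite -[v]mulmx1 -ML mulmxA (_ : v *m M = 0) ?mul0mx //.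
  apply/rowP => i; rewrite !mxE; under eq_bigr do rewrite !mxE.
  by rewrite -coeff fz mcoeff0.
have Rs : R \in s by rewrite mem_paths_of_size.
have iR : (index R s < N)%N by rewrite index_mem.
have := congr1 (fun u : 'rV_N => u 0 (Ordinal iR)) v0.
by rewrite !mxE /e /= nth_index.
Qed.
End GradedEndomorphism.
End Grading.

(** * Freeness *)

Section Freeness.
Variables (m : nat) (K : fieldType).
Hypothesis m_gt0 : (0 < m)%N.

Lemma monomial_ev_morph (A B : lmodType K) (opA : 'I_m.+1 -> A -> A -> A)
    (opB : 'I_m.+1 -> B -> B -> B) (f : {linear A -> B}) a z :
  op_morphism opA opB f ->
  f (monomial_ev opA a z) = monomial_ev opB (f a) z.
Proof.
move=> fM; rewrite /monomial_ev /extend linear_sum; apply: eq_bigr => P _.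
by rewrite linearZ /= (monomial_morph a P fM).
Qed.

Lemma monomial_ev_surj (y : {malg K[Dy m]}) :
  exists z, monomial_ev (@dy_mul K m) << peak m >> z = y.
Proof.
have dyck := dy_mul_dyck K m_gt0.
have yn : normal_span (@dy_mul K m) << peak m >> m.+1 y.
  apply: (peak_generates m_gt0) y => [c x y|i x y|].
  - exact: normal_lin.
  - exact: normal_span_closed.
  - exact: normal_span_le (leq0n _) (normal_gen _ _).
by have [z -> _] := normal_span_image dyck yn; exists z.
Qed.

Lemma monomial_ev_inj (z : {malg K[Dy m]}) :
  monomial_ev (@dy_mul K m) << peak m >> z = 0 -> z = 0.
Proof.
apply: graded_injective; last exact: monomial_ev_surj.
exact: homogeneous_monomial.
Qed.

Import FreeDyck.

Let G : lmodType K := FreeDyck.carrier m K.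
Let opG : 'I_m.+1 -> G -> G -> G := @FreeDyck.qop m K.
Let x0 : G := FreeDyck.cls (FreeDyck.Gen m K).

Lemma free_normal (y : G) : normal_span opG x0 m.+1 y.
Proof.
have dyck : dyck_algebra opG := FreeDyck.qop_dyck m K.
elim/FreeDyck.clsW: y; elim=> [||s hs t ht|c t ht|i s hs t ht].
- exact: normal_span_le (leq0n _) (normal_gen _ _).
- exact: normal_span0.
- rewrite -FreeDyck.clsD; exact: normal_spanD.
- rewrite -FreeDyck.clsZ -[_ *: _]addr0; apply: normal_lin => //; exact: normal_span0.
- rewrite -FreeDyck.qopE; exact: normal_span_closed.
Qed.

(** Both algebras are images of K[Dy] under the evaluation of monomials.  The
    evaluation in K[Dy] is bijective and factors through f. *)
Lemma free_bijective (f : {linear G -> {malg K[Dy m]}}) :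
  op_morphism opG (@dy_mul K m) f -> f x0 = << peak m >> ->
  bijective f.
Proof.
move=> fM fx.
have evf z : f (monomial_ev opG x0 z) =
    monomial_ev (@dy_mul K m) << peak m >> z.
  by rewrite (monomial_ev_morph _ _ fM) fx.
have f_surj y : exists u, f u = y.
  have [z <-] := monomial_ev_surj y.
  by exists (monomial_ev opG x0 z).
have f_inj : injective f.
  move=> u v; move/eqP; rewrite -subr_eq0 -linearB => /eqP fuv.
  apply/eqP; rewrite -subr_eq0; move: (u - v) fuv => {u v} w.
  have dG : dyck_algebra opG := FreeDyck.qop_dyck m K.
  have [z -> _] := normal_span_image dG (free_normal w).
  by rewrite evf => /monomial_ev_inj ->; rewrite /monomial_ev linear0.
have [g gK] := choice f_surj; exists g => // u.
by apply: f_inj; rewrite gK.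
Qed.

(** Free algebras on one generator are unique. *)
Lemma free_isomorphic (F : lmodType K) (op : 'I_m.+1 -> F -> F -> F) (x : F) :
  free_dyck_on_one op x ->
  exists h : {linear F -> G},
    [/\ bijective h, op_morphism op opG h & h x = x0].
Proof.
move=> [dF uF]; have [dG uG] : free_dyck_on_one opG x0 := FreeDyck.free m K.
have [[h [hM hx]] _] := uF _ _ x0 dG.
have [[g [gM gx]] _] := uG _ _ x dF.
exists h; split=> //; exists g.
- have [_ uniq] := uF _ _ x dF.
  apply: (uniq (g \o h) idfun) => [i u v||i u v|] //=; first by rewrite hM gM.
  by rewrite hx gx.
- have [_ uniq] := uG _ _ x0 dG.
  apply: (uniq (h \o g) idfun) => [i u v||i u v|] //=; first by rewrite gM hM.
  by rewrite gx hx.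
Qed.
End Freeness.

Theorem theorem4p3p11 (K : fieldType) (m : nat) (hm : (1 <= m)%N) :
  dyck_algebra (@dy_mul K m) /\
  forall (F : lmodType K) (op : 'I_m.+1 -> F -> F -> F) (x : F),
    free_dyck_on_one op x ->
    dyck_isomorphic op (@dy_mul K m).
Proof.
have dyck := dy_mul_dyck K hm; split=> // F op x free_F.
have [h [h_bij hM hx]] := free_isomorphic free_F.
have [[f [fM fx]] _] := (FreeDyck.free m K).2 _ _ << peak m >> dyck.
exists (f \o h); split=> [|i u v /=]; last by rewrite hM fM.
by apply: bij_comp => //; apply: free_bijective.
Qed.
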